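(* Assume the following hypothesis: for every fixed $\epsilon>0$, $$\sum_{d\le x^{1-\epsilon}}\left|\pi(x;d,1)-\frac{\pi(x)}{\phi(d)}\right| = o(\pi(x)) \quad\text{as } x\to\infty.$$ For each (large) $x$ let $P=P(x)$ be a set of primes less than $x$ such that $$\sum_{\substack{p\le x\\ p\notin P}}\frac1p\ll 1,$$ with implied constant independent of $x$. Then $$\frac{\pi(x,P)}{\pi(x)}\sim \prod_{\substack{p\le x\\ p\notin P}}\left(1-\frac{1}{(p-1)^2}\right)\frac{\Psi(x,P)}{x}\quad\text{as } x\to\infty.$$
   Context: $p,q$ denote primes. $\pi(x)$ is the number of primes $\le x$, $\pi(x;d,a)$ the number of primes $p\le x$ with $p\equiv a \pmod d$, and $\phi$ is Euler's function. For a set $P$ of primes, $\Psi(x,P)=\#\{n\le x:\ p\mid n\Rightarrow p\in P\}$ and $\pi(x,P)=\#\{p\le x \text{ prime}:\ q\mid p-1\Rightarrow q\in P\}$.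
   Formalization: The formal theorem also assumes that 2 lies in P(x) for all large x; otherwise the factor at p = 2 makes the right-hand side 0 while π(x,P) = 1 (only p = 2 counts), so the asymptotic relation fails. *)

(* Defs.v *)
From HB Require Import structures.
From mathcomp Require Import all_boot all_order all_algebra.
From mathcomp Require Import all_classical all_reals all_analysis.
Set Implicit Arguments. Unset Strict Implicit. Unset Printing Implicit Defensive.
Import Order.TTheory GRing.Theory Num.Theory.
Local Open Scope ring_scope.

(* For a real x, the integers n <= x with n >= 0 are exactly n <= truncn x
   (truncn x = floor x for x >= 0, and 0 for x < 0). *)

Definition primepi {R : realType} (x : R) : nat :=
  \sum_(p < (Num.truncn x).+1 | prime p) 1%N.

Definition primepi_ap {R : realType} (x : R) (d a : nat) : nat :=
  \sum_(p < (Num.truncn x).+1 | prime p && (p == a %[mod d])) 1%N.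

Definition Psi {R : realType} (x : R) (P : pred nat) : nat :=
  \sum_(1 <= n < (Num.truncn x).+1 | all (fun q => q \in P) (primes n)) 1%N.

Definition primepiP {R : realType} (x : R) (P : pred nat) : nat :=
  \sum_(p < (Num.truncn x).+1 | prime p && all (fun q => q \in P) (primes p.-1)) 1%N.

(* Main.v *)
Require Import Defs.
From HB Require Import structures.
From mathcomp Require Import all_boot all_order all_algebra.
From mathcomp Require Import all_classical all_reals all_analysis.
From mathcomp Require Import ring lra zify.
Import Order.TTheory GRing.Theory Num.Theory.
Import numFieldNormedType.Exports.
Local Open Scope classical_set_scope.
Local Open Scope ring_scope.

(* Let Q be the set of excluded primes q <= x, and compare n <= x uniform (local densities
   1/d) with n = p - 1 for p <= x prime (densities 1/phi(d)); both are controlled on average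
   over d <= x^(1-eps), the second one by hypothesis.

   - Primes of Q below a fixed w are sieved exactly, and this is where the factors 1 - 1/(p-1)^2
     come from. Above w, 1/phi(d) and 1/d nearly agree for d with boundedly many prime factors,
     so Bonferroni's inequality truncated at k factors produces the same main sum for both
     sequences; since the sum of 1/q over Q is bounded, its error tends to 0 as k grows.
   - Divisors d > x^(1-2 eps) are beyond the level. If n has such a divisor with at most k prime
     factors, then n has at most k prime factors in (x^(2 eps), x^(1/4)]; by Turan-Kubilius this
     is rare when eps is small, as the sum of 1/p over that window is large.
   - The asymptotic relation then follows from Psi(x, P) >= c x. The logarithmic density of the
     integers free of Q is bounded below. By pigeonhole some window (b, b^4], b a fixed power
     of x, has little of Q in it. Starting from an integer free of Q below sqrt x, multiply by
     random primes of (b, b^2] outside Q until the product is within a factor b^4 of x; the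
     last prime factor is then counted by Chebyshev, and Q costs little by the choice of b. *)

(** * Chebyshev and Mertens estimates *)

(** The rarity of the integers with a divisor beyond the level is not enough by itself: such an
    integer may contribute many terms to the truncated inclusion-exclusion. Their total is split by
    2 y <= lam y^2 + 1 / lam, so a second moment of the number of divisors is needed as well.
    Squaring would push the moduli past the level. Hence only primes up to x^(1/(4 k)) enter the
    square; an integer up to x has at most 4 k prime factors beyond that bound, and these cost a
    factor 2^(4 k).

    This dictates the order of the choices: k from the target error, then w, then lam, then the
    length of the window for Turan-Kubilius and with it eps, and x last. So eps is fixed but
    arbitrarily small, which is the form in which the hypothesis is given.

    The sieve errors are additive, and only Psi(x, P) >= c x turns them into a relative error. A
    bound for the logarithmic density does not speak of the single scale x; the random
    multiplication carries the mass from below sqrt x to that scale. *)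

Lemma prime_dvd_prod_primes (s : seq nat) (p : nat) :
  prime p -> all prime s -> (p %| \prod_(q <- s) q)%N -> p \in s.
Proof.
move=> pp; elim: s => [|a s IH] /=.
  by rewrite big_nil dvdn1 => _ /eqP p1; rewrite p1 in pp.
move=> /andP[pa ps]; rewrite big_cons Euclid_dvdM// inE => /orP[|/(IH ps) ->]; last by rewrite orbT.
by rewrite dvdn_prime2// => ->.
Qed.

Lemma prod_primes_dvd (s : seq nat) (m : nat) :
  uniq s -> all prime s -> (\prod_(q <- s) q %| m)%N = all (fun q => q %| m)%N s.
Proof.
elim: s => [|a s IH] /=; first by rewrite big_nil dvd1n.
move=> /andP[nas us] /andP[pa ps]; rewrite big_cons Gauss_dvd ?IH//.
rewrite prime_coprime//; apply: contra nas; exact: prime_dvd_prod_primes.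
Qed.

Lemma prime_dvd_fact (p m : nat) : prime p -> (p %| m`!)%N -> (p <= m)%N.
Proof.
move=> pp; elim: m => [|m IH].
  by rewrite fact0 dvdn1 => /eqP p1; rewrite p1 in pp.
rewrite factS Euclid_dvdM// => /orP[/dvdn_leq->//|/IH/leqW//].
Qed.

Lemma central_bin_le (m : nat) : ('C(m.*2, m) <= 4 ^ m)%N.
Proof.
have -> : (4 ^ m = (1 + 1) ^ m.*2)%N by rewrite -mul2n expnM.
rewrite expnDn.
have hm : (m < m.*2.+1)%N by rewrite ltnS -addnn leq_addr.
by rewrite (bigD1 (Ordinal hm))//= !exp1n !muln1 leq_addr.
Qed.

(** The primes in (m, 2 m] divide the central binomial coefficient, which is at most 4^m. With m the
    upper half of n, the exponents add up to 4 m <= 3 n once n >= 2: the factor 3 absorbs the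
    rounding. *)
Lemma primorial_le (n : nat) : (\prod_(0 <= p < n.+1 | prime p) p <= 4 ^ (3 * n))%N.
Proof.
elim/ltn_ind: n => n IH.
have [n2|n2] := ltnP n 2.
  by case: n n2 {IH} => [|[|//]] _; rewrite unlock.
pose m := uphalf n.
have mn : (m < n)%N by rewrite /m; lia.
have nm : (n <= m.*2)%N by rewrite /m; lia.
apply: (@leq_trans (\prod_(0 <= p < m.*2.+1 | prime p) p)%N).
  rewrite [leqRHS](@big_cat_nat _ _ _ n.+1) //=.
  apply: leq_pmulr; apply: prodn_cond_gt0 => p; exact: prime_gt0.
rewrite (@big_cat_nat _ _ _ m.+1) //=; last lia.
apply: (@leq_trans (4 ^ (3 * m) * 4 ^ m)%N); last first.
  by rewrite -expnD leq_pexp2l// /m; lia.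
apply: leq_mul; first exact: IH.
apply: leq_trans (central_bin_le m).
apply: dvdn_leq; first by rewrite bin_gt0 -addnn leq_addr.
rewrite -big_filter prod_primes_dvd ?filter_uniq ?iota_uniq//; last first.
  by apply/allP => p; rewrite mem_filter => /andP[].
apply/allP => p; rewrite mem_filter mem_index_iota => /andP[pp /andP[mp pm]].
have : (p %| 'C(m.*2, m) * (m`! * m`!))%N.
  have mm : (m <= m.*2)%N by lia.
  have := bin_fact mm; rewrite (_ : m.*2 - m = m)%N; last lia.
  move=> ->.
  by apply: dvdn_fact; rewrite prime_gt0//=.
rewrite Euclid_dvdM// => /orP[//|].
by rewrite Euclid_dvdM// orbb => /(prime_dvd_fact _ _ pp); lia.
Qed.

Section Mertens.
Variable R : realType.
Implicit Types (n p : nat).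
Local Notation ln := (@ln R).

Lemma ln_nat_ge0 n : 0 <= ln n%:R.
Proof. by case: n => [|n]; [rewrite ln0|rewrite ln_ge0// ler1n]. Qed.

Lemma ln_prod_nat (I : Type) (r : seq I) (P : pred I) (F : I -> nat) :
  (forall i, P i -> (0 < F i)%N) ->
  ln (\prod_(i <- r | P i) F i)%:R = \sum_(i <- r | P i) ln (F i)%:R.
Proof.
move=> F0; suff [] : ln (\prod_(i <- r | P i) F i)%:R = \sum_(i <- r | P i) ln (F i)%:R /\
  (0 < \prod_(i <- r | P i) F i)%N by [].
apply: (big_ind2 (fun (a : nat) (b : R) => ln a%:R = b /\ (0 < a)%N)).
- by rewrite ln1.
- move=> a b c d [<- a0] [<- b0]; split; last by rewrite muln_gt0 a0.
  by rewrite natrM lnM// posrE ltr0n.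
- by move=> i /F0.
Qed.

Lemma theta_le n : \sum_(0 <= p < n.+1 | prime p) ln p%:R <= 6 * n%:R.
Proof.
rewrite -ln_prod_nat; last by move=> p /prime_gt0.
have := primorial_le n; rewrite -(ler_nat R) => h.
apply: (@le_trans _ _ (ln (4 ^ (3 * n))%:R)).
  rewrite ler_ln// posrE ltr0n ?expn_gt0//.
  by rewrite prodn_cond_gt0// => p /prime_gt0.
have -> : (4 ^ (3 * n) = 2 ^ (6 * n))%N by rewrite -[4%N]/(2 ^ 2)%N -expnM mulnA.
rewrite natrX lnXn// -(mulr_natr (ln _)) natrM.
rewrite -[leRHS]mul1r ler_wpM2r//.
by rewrite -[2%:R]/(1 + 1) le_ln1Dx//; lra.
Qed.

Lemma ln_nat_logn n N : (0 < n <= N)%N ->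
  ln n%:R = \sum_(0 <= p < N.+1 | prime p) (logn p n)%:R * ln p%:R.
Proof.
move=> /andP[n0 nN].
have := partnT n0; rewrite (widen_partn _ nN) => {1}<-.
rewrite (eq_bigr (fun p => if prime p then (p ^ logn p n)%N else 1%N)); last first.
  by move=> p _; case: ifP => // np; rewrite lognE np.
rewrite -big_mkcondr/= ln_prod_nat; last by move=> p pp; rewrite expn_gt0 prime_gt0.
apply: eq_bigr => p pp.
by rewrite natrX lnXn ?mulr_natl// ltr0n prime_gt0.
Qed.

Lemma ln_fact_logn n N : (n <= N)%N ->
  ln (n`!)%:R = \sum_(0 <= p < N.+1 | prime p) (logn p n`!)%:R * ln p%:R.
Proof.
elim: n => [|n IH] nN.
  rewrite fact0 ln1 big1// => p pp.
  by rewrite logn1 mul0r.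
rewrite factS natrM lnM ?posrE ?ltr0n ?fact_gt0// IH ?(ltnW nN)//.
rewrite (ln_nat_logn _ N)// -big_split/=.
by apply: eq_bigr => p pp; rewrite lognM ?fact_gt0// natrD mulrDl.
Qed.

Lemma ln_fact_le n : ln (n`!)%:R <= n%:R * ln n%:R.
Proof.
case: n => [|n]; first by rewrite fact0 ln1 mul0r.
rewrite mulr_natl -lnXn ?ltr0n// -natrX ler_ln ?posrE ?ltr0n ?expn_gt0 ?fact_gt0//.
by rewrite ler_nat fact_prod big_add1 /= big_mkord (leq_trans (@leq_prod _ _ _ _ (fun=> n.+1) _))//
  prod_nat_const card_ord.
Qed.

Lemma ln_succ_le n : (0 < n)%N -> ln n.+1%:R <= ln n%:R + n%:R^-1.
Proof.
move=> n0; have n0' : (0 : R) < n%:R by rewrite ltr0n.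
have -> : n.+1%:R = n%:R * (1 + n%:R^-1) :> R.
  by rewrite mulrDr mulr1 divff ?gt_eqF// natr1.
have h : (0 : R) < n%:R^-1 by rewrite invr_gt0.
rewrite lnM ?posrE//.
by rewrite lerD2l le_ln1Dx//; lra.
Qed.

Lemma ln_fact_ge n : n%:R * ln n%:R - n%:R <= ln (n`!)%:R.
Proof.
elim: n => [|[|n] IH]; first by rewrite fact0 ln1 mul0r subrr.
  by rewrite ln1; lra.
rewrite factS natrM lnM ?posrE ?ltr0n ?fact_gt0//.
have := ln_succ_le n.+1 isT.
have n0 : (0 : R) < n.+1%:R by rewrite ltr0n.
rewrite -(ler_pM2l n0) mulrDr divff ?gt_eqF// => h.
have e : n.+2%:R = n.+1%:R + 1 :> R by rewrite natr1.
have e2 : n.+2%:R * ln n.+2%:R = (n.+1%:R + 1) * ln n.+2%:R by rewrite {1}e.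
rewrite e2 {2}e; lra.
Qed.

Lemma geo_inv_le p K : (1 < p)%N ->
  \sum_(1 <= k < K.+1) ((p ^ k)%:R^-1 : R) <= (p%:R - 1)^-1.
Proof.
move=> p1; have p1' : (1 : R) < p%:R by rewrite ltr1n.
suff -> : \sum_(1 <= k < K.+1) ((p ^ k)%:R^-1 : R) =
   (p%:R - 1)^-1 - (p%:R - 1)^-1 * (p ^ K)%:R^-1.
  by rewrite gerBl mulr_ge0// invr_ge0//; lra.
elim: K => [|K IH]; first by rewrite big_geq// expn0 invr1 mulr1 subrr.
rewrite big_nat_recr//= IH expnS natrM.
have h : (0 : R) < (p ^ K)%:R by rewrite ltr0n expn_gt0; lia.
by field; apply/and3P; split; rewrite ?gt_eqF//; lra.
Qed.

Lemma logn_fact_le p n : prime p -> (logn p n`!)%:R <= n%:R / (p%:R - 1) :> R.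
Proof.
move=> pp; rewrite logn_fact// natr_sum.
apply: (@le_trans _ _ (n%:R * \sum_(1 <= k < n.+1) (p ^ k)%:R^-1)).
  rewrite mulr_sumr ler_sum// => k _.
  rewrite ler_pdivlMr ?ltr0n ?expn_gt0 ?prime_gt0//.
  by rewrite -natrM ler_nat leq_trunc_div.
by rewrite ler_wpM2l// geo_inv_le// prime_gt1.
Qed.

Lemma logn_fact_gt p n : prime p -> (p <= n)%N -> n%:R / p%:R - 1 <= (logn p n`!)%:R :> R.
Proof.
move=> pp pn; rewrite logn_fact//.
have p0 := prime_gt0 pp.
apply: (@le_trans _ _ (n %/ p)%:R); last first.
  by rewrite ler_nat big_ltn ?expn1 ?leq_addr// ltnS; lia.
rewrite lerBlDr natr1 ler_pdivrMr ?ltr0n// -natrM ler_nat ltnW// ltn_ceil//.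
Qed.

Lemma sum_ln_div_le n :
  \sum_(0 <= p < n.+1 | prime p) ln p%:R / (p%:R * (p%:R - 1)) <= 2.
Proof.
case: n => [|n]; first by rewrite unlock.
(* telescoping: [(ln (m-1) + 2) / (m-1) - (ln m + 2) / m >= ln m / (m (m-1))] *)
suff : \sum_(0 <= p < n.+2 | prime p) ln p%:R / (p%:R * (p%:R - 1)) <=
   2 - (ln n.+1%:R + 2) / n.+1%:R.
  move/le_trans; apply; rewrite gerBl divr_ge0// addr_ge0// ln_nat_ge0//.
elim: n => [|n IH].
  by rewrite big_mkcond unlock/= !addr0 ln1; lra.
rewrite big_mkcond big_nat_recr//= -big_mkcond/=.
set a := (n.+1%:R : R) in IH *.
have a1 : 1 <= a by rewrite ler1n.
have -> : n.+2%:R = a + 1 :> R by rewrite natr1.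
have h := ln_succ_le n.+1 isT.
have h' : ln (a + 1) <= ln a + a^-1 by rewrite natr1.
have := IH; set S := \sum_(_ <= _ < _ | _) _ => {}IH.
apply: (@le_trans _ _ (S + ln (a + 1) / ((a + 1) * (a + 1 - 1)))).
  by case: ifP => // _; rewrite lerD2l divr_ge0 ?mulr_ge0 ?ln_ge0//; lra.
apply: (le_trans (lerD IH (lexx _))).
rewrite -subr_ge0.
have -> : 2 - (ln (a + 1) + 2) / (a + 1) - (2 - (ln a + 2) / a + ln (a + 1) / ((a + 1) * (a + 1 - 1)))
  = ((a + 1) * (ln a + a^-1 - ln (a + 1)) + (1 - a^-1)) / (a * (a + 1)).
  by field; apply/andP; split; rewrite gt_eqF//; lra.
have a0 : a^-1 <= 1 by rewrite invf_le1//; lra.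
by rewrite divr_ge0 ?mulr_ge0// ?(addr_ge0 (mulr_ge0 _ _))// ?subr_ge0//; lra.
Qed.

(** Legendre's formula bounds the exponent of p in n! by n / (p - 1), and 1 / (p - 1) = 1 / p + 1 /
    (p (p - 1)). The constant 3 is 1 from [ln_fact_ge] plus 2 from [sum_ln_div_le]. *)
Lemma mertens_ge n : (0 < n)%N ->
  ln n%:R - 3 <= \sum_(0 <= p < n.+1 | prime p) ln p%:R / p%:R.
Proof.
move=> n0; have n0' : (0 : R) < n%:R by rewrite ltr0n.
rewrite -(ler_pM2l n0').
have h1 := ln_fact_ge n; have h2 := sum_ln_div_le n.
suff h3 : ln n`!%:R <= n%:R * (\sum_(0 <= p < n.+1 | prime p) ln p%:R / p%:R +
  \sum_(0 <= p < n.+1 | prime p) ln p%:R / (p%:R * (p%:R - 1))).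
  by move: h1 h2 h3; set S := \sum_(_ <= _ < _ | _) _; set T := \sum_(_ <= _ < _ | _) _; nra.
rewrite (ln_fact_logn n n)// -big_split mulr_sumr/= ler_sum// => p pp.
have p1 : (1 : R) < p%:R by rewrite ltr1n prime_gt1.
apply: (le_trans (ler_wpM2r (ln_nat_ge0 p) (logn_fact_le _ n pp))).
rewrite le_eqVlt; apply/orP; left; apply/eqP; field.
by apply/andP; split; rewrite gt_eqF//; lra.
Qed.

(** The exponent of p in n! is at least n / p - 1; the losses of 1 add up to the Chebyshev function,
    whence the 6 of [theta_le]. *)
Lemma mertens_le n : (0 < n)%N ->
  \sum_(0 <= p < n.+1 | prime p) ln p%:R / p%:R <= ln n%:R + 6.
Proof.
move=> n0; have n0' : (0 : R) < n%:R by rewrite ltr0n.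
rewrite -(ler_pM2l n0').
have h1 := ln_fact_le n; have h2 := theta_le n.
suff h3 : n%:R * (\sum_(0 <= p < n.+1 | prime p) ln p%:R / p%:R) -
  \sum_(0 <= p < n.+1 | prime p) ln p%:R <= ln n`!%:R.
  by move: h1 h2 h3; set S := \sum_(_ <= _ < _ | _) _; set T := \sum_(_ <= _ < _ | _) _; nra.
rewrite (ln_fact_logn n n)// mulr_sumr -sumrB/= big_nat_cond [leRHS]big_nat_cond.
apply: ler_sum => p /andP[/andP[_ pn] pp].
have := ler_wpM2r (ln_nat_ge0 p) (logn_fact_gt _ n pp pn).
by rewrite mulrBl mul1r mulrAC mulrA.
Qed.

End Mertens.

(** * Primes in windows *)

Section PrimeWindows.
Variable R : realType.
Implicit Types (n p N : nat) (a b t : R).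
Local Notation ln := (@ln R).

Lemma big_nat_le_real (b : R) N (P : pred nat) (F : nat -> R) : 0 <= b -> b < N.+1%:R ->
  \sum_(0 <= p < N.+1 | P p && (p%:R <= b)) F p =
  \sum_(0 <= p < (Num.truncn b).+1 | P p) F p.
Proof.
move=> b0 bN; have tN : (Num.truncn b <= N)%N by rewrite truncn_le_nat.
rewrite [RHS](big_nat_widen _ _ N.+1)//; apply: eq_bigl => p.
by rewrite -truncn_ge_nat.
Qed.

(** Here 10 = 3 + 6 + 1, where the 1 pays for replacing b by its integer part. *)
Lemma mertens_window a b N : 1 <= a -> a <= b -> b < N.+1%:R ->
  ln b - ln a - 10 <= \sum_(0 <= p < N.+1 | prime p && (a < p%:R <= b)) ln p%:R / p%:R.
Proof.
move=> a1 ab bN.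
have b1 : 1 <= b by lra.
have ta : (0 < Num.truncn a)%N by rewrite truncn_gt0.
have tb : (0 < Num.truncn b)%N by rewrite truncn_gt0.
have : \sum_(0 <= p < N.+1 | prime p && (p%:R <= b)) ln p%:R / p%:R =
   \sum_(0 <= p < N.+1 | prime p && (p%:R <= a)) ln p%:R / p%:R +
   \sum_(0 <= p < N.+1 | prime p && (a < p%:R <= b)) ln p%:R / p%:R :> R.
  rewrite (bigID (fun p => p%:R <= a)) /=; congr (_ + _); apply: eq_bigl => p.
    rewrite -andbA; congr (_ && _); case: (lerP p%:R a) => h; rewrite ?andbF ?andbT//.
    by apply: le_trans ab.
  by rewrite -andbA -ltNge; congr (_ && _); rewrite andbC.
rewrite !big_nat_le_real//; try lra.
have := mertens_ge R _ tb; have := mertens_le R _ ta.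
have h1 : ln (Num.truncn a)%:R <= ln a.
  by rewrite ler_ln ?posrE ?ltr0n// ?truncn_le; lra.
have h2 : ln b <= ln (Num.truncn b)%:R + 1.
  have tb0 : (0 : R) < (Num.truncn b)%:R by rewrite ltr0n.
  have h : b <= (Num.truncn b)%:R * 2.
    have := truncnS_gt b; rewrite -natr1.
    have : (1 : R) <= (Num.truncn b)%:R by rewrite ler1n.
    by lra.
  apply: (@le_trans _ _ (ln ((Num.truncn b)%:R * 2))).
    by rewrite ler_ln ?posrE ?mulr_gt0//; lra.
  rewrite lnM ?posrE// lerD2l -[2%:R]/(1 + 1) le_ln1Dx//; lra.
by set S := \sum_(_ <= _ < _ | _) _; set T := \sum_(_ <= _ < _ | _) _;
  set U := \sum_(_ <= _ < _ | _) _ => *; lra.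
Qed.

Lemma recip_window a b N : 1 < a -> a <= b -> b < N.+1%:R ->
  (ln b - ln a - 10) / ln b <= \sum_(0 <= p < N.+1 | prime p && (a < p%:R <= b)) p%:R^-1.
Proof.
move=> a1 ab bN.
have b0 : 0 < ln b by rewrite ln_gt0//; lra.
rewrite ler_pdivrMr// mulr_suml.
apply: le_trans (mertens_window _ _ _ (ltW a1) ab bN) _.
apply: ler_sum => p /andP[pp /andP[ap pb]].
by rewrite mulrC ler_wpM2l ?invr_ge0// ler_ln ?posrE//; lra.
Qed.

(** Each of the m windows (u, u^4] contributes at least (3 ln u - 10) / (4 ln u), which is at least
    1 / 2 as ln u >= 10. *)
Lemma recip_windows t (m : nat) N : 10 <= ln t -> t ^+ (4 ^ m) < N.+1%:R ->
  (m%:R : R) / 2 <= \sum_(0 <= p < N.+1 | prime p && (t < p%:R <= t ^+ (4 ^ m))) p%:R^-1.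
Proof.
move=> lt; have t1 : 1 < t.
  by rewrite ltNge; apply/negP => /ln_le0; lra.
elim: m => [|m IH] hN.
  by rewrite mul0r sumr_ge0// => p _; rewrite invr_ge0.
have le1 : t ^+ (4 ^ m) <= t ^+ (4 ^ m.+1).
  by rewrite ler_weXn2l ?leq_pexp2l// ltW.
have t1m : 1 < t ^+ (4 ^ m) by rewrite exprn_egt1// -lt0n expn_gt0.
have lnm : 10 <= ln (t ^+ (4 ^ m)).
  rewrite lnXn; last lra.
  have : (1 : R) <= (4 ^ m)%:R by rewrite ler1n expn_gt0.
  by rewrite -(mulr_natr (ln t)); nra.
have e : ln (t ^+ (4 ^ m.+1)) = 4 * ln (t ^+ (4 ^ m)).
  by rewrite expnS mulnC exprM lnXn ?mulr_natl//; lra.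
rewrite (bigID (fun p => p%:R <= t ^+ (4 ^ m))) /=.
have -> : m.+1%:R / 2 = m%:R / 2 + 1/2 :> R by rewrite -natr1; lra.
apply: lerD.
  apply: le_trans (IH (le_lt_trans le1 hN)) _.
  rewrite le_eqVlt; apply/orP; left; apply/eqP; apply: eq_bigl => p.
  rewrite -andbA; congr (_ && _); rewrite -andbA; congr (_ && _).
  case: (lerP p%:R (t ^+ (4 ^ m))) => h; rewrite ?andbF ?andbT//; symmetry.
  by apply: le_trans le1.
apply: (@le_trans _ _ (\sum_(0 <= p < N.+1 | prime p && (t ^+ (4 ^ m) < p%:R <= t ^+ (4 ^ m.+1)))
  p%:R^-1)).
  apply: le_trans (recip_window _ _ _ t1m le1 hN).
  rewrite e; rewrite ler_pdivlMr; lra.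
rewrite le_eqVlt; apply/orP; left; apply/eqP; apply: eq_bigl => p.
rewrite -andbA -ltNge; congr (_ && _).
case: (ltrP (t ^+ (4 ^ m)) p%:R) => h; rewrite ?andbF//= andbT.
suff -> : t < p%:R by [].
by apply: le_lt_trans h; apply: ler_eXnr; rewrite ?expn_gt0// ltW.
Qed.

(** The exponent 11 exceeds the error 10 of [mertens_window] by one, so the sum of ln p / p over the
    window is at least 1, while each term is at most e^11 ln t / t. *)
Lemma prime_count_window t N : expR 11 <= t -> t < N.+1%:R ->
  t / (expR 11 * ln t) <=
  \sum_(0 <= p < N.+1 | prime p && (t / expR 11 < p%:R <= t)) 1.
Proof.
move=> tK tN; have K0 := expR_gt0 (11 : R).
have K1 : 1 < expR (11 : R) by rewrite expR_gt1; lra.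
have t0 : 0 < t by lra.
have l0 : 0 < ln t by rewrite ln_gt0//; lra.
have a1 : 1 <= t / expR 11 by rewrite ler_pdivlMr// mul1r.
have ab : t / expR 11 <= t by rewrite ler_pdivrMr// ler_peMr//; lra.
have h := mertens_window _ _ _ a1 ab tN.
rewrite ler_pdivrMr ?mulr_gt0// mulr_suml.
apply: (@le_trans _ _ (t * (ln t - ln (t / expR 11) - 10))).
  by rewrite ln_div ?posrE// expRK; lra.
apply: le_trans (ler_wpM2l (ltW t0) h) _.
rewrite mulr_sumr; apply: ler_sum => p /andP[pp /andP[p1 p2]].
have p0 : 0 < (p%:R : R) by rewrite ltr0n prime_gt0.
rewrite mul1r mulrA ler_pdivrMr// mulrAC.
rewrite ltr_pdivrMr// in p1.
apply: ler_pM => //; [exact: ltW|exact: ln_nat_ge0|by rewrite mulrC ltW|].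
by rewrite ler_ln ?posrE.
Qed.

End PrimeWindows.

(** * Integers free of a sparse set of primes *)

Lemma sum_multiples (V : nmodType) (p t : nat) (F : nat -> V) : (0 < p)%N ->
  \sum_(0 <= n < t.+1 | (p %| n)%N) F n = \sum_(0 <= m < (t %/ p).+1) F (m * p)%N.
Proof.
move=> p0; elim: t => [|t IH].
  by rewrite div0n big_mkcond !big_nat1 dvdn0 mul0n.
rewrite big_mkcond big_nat_recr//= -big_mkcond IH divnS//.
case: ifPn => /= d; last by rewrite addr0 add0n.
rewrite add1n [RHS]big_nat_recr//=; congr (_ + F _).
by have := divnS t p0; rewrite d add1n => <-; rewrite divnK.
Qed.

Lemma exchange_sum_multiples (R : pzSemiRingType) (p t : nat) (P : pred nat) (F : nat -> nat -> R) :
  (forall q, P q -> (0 < q)%N) ->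
  \sum_(0 <= n < t.+1) \sum_(0 <= q < p | P q && (q %| n)%N) F q n =
  \sum_(0 <= q < p | P q) \sum_(0 <= m < (t %/ q).+1) F q (m * q)%N.
Proof.
move=> P0; under eq_bigr do rewrite big_mkcondr/=.
rewrite exchange_big/=; apply: eq_bigr => q /P0 q0.
by rewrite -big_mkcond sum_multiples.
Qed.

Definition sifted (Q : pred nat) (n : nat) : bool :=
  (0 < n)%N && all (fun q => ~~ Q q) (primes n).

Lemma siftedP (Q : pred nat) (n : nat) :
  reflect ((0 < n)%N /\ forall q, prime q -> (q %| n)%N -> ~~ Q q) (sifted Q n).
Proof.
apply: (iffP andP) => -[n0 h]; split=> //.
  by move=> q pq qn; apply: (allP h); rewrite mem_primes pq n0.
by apply/allP => q; rewrite mem_primes => /and3P[pq _ qn]; apply: h.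
Qed.

Lemma siftedM (Q : pred nat) (m p : nat) :
  prime p -> sifted Q (m * p) = sifted Q m && ~~ Q p.
Proof.
move=> pp; apply/siftedP/idP.
  move=> [mp h]; apply/andP; split; last by apply: h => //; rewrite dvdn_mull.
  apply/siftedP; split; first by move: mp; rewrite muln_gt0 => /andP[].
  by move=> q pq qm; apply: h => //; rewrite dvdn_mulr.
move=> /andP[/siftedP[m0 h] Qp]; split; first by rewrite muln_gt0 m0 prime_gt0.
move=> q pq; rewrite Euclid_dvdM// => /orP[/(h _ pq)//|].
by rewrite dvdn_prime2// => /eqP->.
Qed.

Section SiftedLowerBound.
Variable R : realType.
Implicit Types (n p : nat).
Local Notation ln := (@ln R).

Lemma prime_list_exp_le (b : R) (s : seq nat) n : 0 <= b -> uniq s -> all prime s ->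
  (forall p, p \in s -> (p %| n)%N /\ b <= p%:R) -> (0 < n)%N -> b ^+ size s <= n%:R.
Proof.
move=> b0 us ps sn n0.
apply: (@le_trans _ _ (\prod_(p <- s) p)%:R); last first.
  rewrite ler_nat dvdn_leq// prod_primes_dvd//.
  by apply/allP => p /sn[].
rewrite natr_prod.
elim: s {us ps} sn => [|a s IH] sn; first by rewrite big_nil expr0.
rewrite big_cons exprS; apply: ler_pM => //; first by rewrite exprn_ge0.
  by have [] := sn a (mem_head _ _).
by apply: IH => p ps; apply: sn; rewrite inE ps orbT.
Qed.

(** The surviving multiples of q are q m with m <= z / q surviving, so they carry at most 1 / q of
    the sum. With weights 1 / n this involves no rounding error, so the primes can be removed one at
    a time. The term n = 0 vanishes because the inverse of 0 is 0. *)
Lemma harmonic_sieve (z : nat) (s : seq nat) : all prime s ->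
  (\prod_(q <- s) (1 - q%:R^-1)) * (\sum_(0 <= n < z.+1) n%:R^-1) <=
  \sum_(0 <= n < z.+1 | all (fun q => ~~ (q %| n)%N) s) n%:R^-1 :> R.
Proof.
elim: s => [|q s IH] /=; first by rewrite big_nil mul1r.
move=> /andP[pq ps]; rewrite big_cons -mulrA.
have q0 : (0 : R) < q%:R by rewrite ltr0n prime_gt0.
have q1 : 0 <= 1 - (q%:R^-1 : R).
  by rewrite subr_ge0 invf_le1// ler1n prime_gt0.
apply: le_trans (ler_wpM2l q1 (IH ps)) _.
pose P n := all (fun q0 => ~~ (q0 %| n)%N) s.
rewrite mulrBl mul1r lerBlDr [leLHS](bigID (fun n => q %| n)%N)/= addrC.
apply: lerD.
  by rewrite le_eqVlt; apply/orP; left; apply/eqP; apply: eq_bigl => n; rewrite andbC.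
rewrite big_mkcondl sum_multiples ?prime_gt0//= mulr_sumr.
apply: (@le_trans _ _ (\sum_(0 <= m < (z %/ q).+1 | P m) q%:R^-1 * m%:R^-1)).
  rewrite [leRHS]big_mkcond; apply: ler_sum => m _.
  case: ifPn => [h|_]; last by case: ifP => // _; rewrite mulr_ge0 ?invr_ge0.
  suff -> : P m by rewrite natrM invfM mulrC.
  apply/allP => a /(allP h); apply: contra => am; exact: dvdn_mulr.
rewrite [leRHS](@big_cat_nat _ _ _ (z %/ q).+1)//= ?ltnS ?leq_div//.
by rewrite lerDl sumr_ge0// => m _; rewrite mulr_ge0 ?invr_ge0.
Qed.

Lemma expR_N2_le (t : R) : 0 <= t <= 1 / 2 -> expR (- (2 * t)) <= 1 - t.
Proof.
move=> /andP[t0 t1]; rewrite expRN.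
have h := expR_ge1Dx (2 * t).
rewrite -[leLHS]mul1r ler_pdivrMr; last by apply: lt_le_trans h; lra.
by apply: (@le_trans _ _ ((1 - t) * (1 + 2 * t))); [nra|rewrite ler_wpM2l//; lra].
Qed.

Lemma ln_le_harmonic (z : nat) : ln z%:R <= \sum_(0 <= n < z.+1) n%:R^-1.
Proof.
have [->|z0] := posnP z; first by rewrite ln0// big_nat1 invr0.
apply: (@le_trans _ _ (ln z.+1%:R)); first by rewrite ler_ln ?posrE ?ltr0n ?ler_nat.
elim: z {z0} => [|z IH]; first by rewrite ln1 big_nat1 invr0.
rewrite big_nat_recr//=; apply: le_trans (ln_succ_le R z.+1 isT) _.
by rewrite lerD2r.
Qed.

Lemma harmonic_sifted (Q : pred nat) (z : nat) (C : R) :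
  \sum_(0 <= q < z.+1 | prime q && Q q) q%:R^-1 <= C ->
  expR (- (2 * C)) * ln z%:R <= \sum_(0 <= n < z.+1 | sifted Q n) n%:R^-1.
Proof.
move=> hC; pose s := [seq q <- index_iota 0 z.+1 | prime q && Q q].
have ps : all prime s by apply/allP => q; rewrite mem_filter => /andP[/andP[]].
apply: (@le_trans _ _ ((\prod_(q <- s) (1 - q%:R^-1)) * (\sum_(0 <= n < z.+1) n%:R^-1))).
  apply: ler_pM; rewrite ?expR_ge0 ?ln_nat_ge0 ?ln_le_harmonic//.
  apply: (@le_trans _ _ (expR (\sum_(q <- s) - (2 * q%:R^-1)))).
    rewrite ler_expR sumrN lerN2 -mulr_sumr ler_wpM2l//.
    by rewrite big_filter.
  rewrite expR_sum big_seq [leRHS]big_seq; apply: ler_prod => q /(allP ps) pq.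
  rewrite expR_ge0/= expR_N2_le// invr_ge0 ler0n/=.
  rewrite -div1r ler_pdivrMr ?ltr0n ?prime_gt0//.
  have : (2 : R) <= q%:R by rewrite ler_nat prime_gt1.
  lra.
apply: le_trans (harmonic_sieve z s ps) _.
rewrite big_nat_cond [leRHS]big_nat_cond big_mkcond [leRHS]big_mkcond.
apply: ler_sum => n _; case: ifPn => [/andP[/andP[_ nz] h]|_]; last first.
  by case: ifP => // _; rewrite invr_ge0.
have [->|n0] := posnP n; first by rewrite invr0.
rewrite nz/= ifT//; apply/siftedP; split=> // q pq qn; apply/negP => Qq.
have : q \in s.
  by rewrite mem_filter pq Qq mem_index_iota/= (leq_ltn_trans _ nz)// dvdn_leq.
by move/(allP h); rewrite qn.
Qed.

End SiftedLowerBound.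

(** * Moving sifted integers up to the scale of N *)

Section Core.
Variables (R : realType) (N s : nat) (b : R) (Q : pred nat) (C : R).
Local Notation ln := (@ln R).
Hypothesis s2 : (2 <= s)%N.
Hypothesis bN : b ^+ (4 * s) = N%:R.
Hypothesis lnb : 20 <= ln b.
Hypothesis hC : \sum_(0 <= q < N.+1 | prime q && Q q) q%:R^-1 <= C.
Let c1 := expR (- (2 * C)).
Let K := expR (11 : R).
(** Makes the loss due to Q in [sifted_count_core], which is L eta N = c1 s N / (4 K), half of the
    main term c1 s N / (2 K). *)
Let eta := c1 / (16 * K).
Hypothesis eta8 : eta <= 1 / 8.
Hypothesis share : \sum_(0 <= q < N.+1 | [&& prime q, Q q & b < q%:R <= b ^+ 4]) q%:R^-1 <= eta.

Let L := (4 * s)%N.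
Let I (p : nat) := [&& prime p, ~~ Q p & b < p%:R <= b ^+ 2].
Let sg : R := \sum_(0 <= p < N.+1 | I p) p%:R^-1.

Local Lemma b_gt : K < b.
Proof.
have b0 : 0 < b by rewrite ltNge; apply/negP => /ln0; move: lnb => /[swap] ->; lra.
by rewrite /K -[ltRHS]lnK ?posrE// ltr_expR; apply: lt_le_trans lnb; lra.
Qed.

Local Lemma K_gt1 : 1 < K. Proof. by rewrite expR_gt1; lra. Qed.

Local Lemma b_gt1 : 1 < b. Proof. by have := b_gt; have := K_gt1; lra. Qed.

Local Lemma bX_le_N (m : nat) : (m <= L)%N -> b ^+ m <= N%:R.
Proof. by move=> mL; rewrite -bN ler_weXn2l// ltW// b_gt1. Qed.

Local Lemma N_gt0 : (0 < N)%N.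
Proof. by rewrite -(ltr0n R) -bN exprn_gt0//; have := b_gt1; lra. Qed.

Local Lemma I_prime p : I p -> prime p. Proof. by case/and3P. Qed.

Local Lemma I_gt0 p : I p -> (0 < p)%N. Proof. by move/I_prime/prime_gt0. Qed.

(** The window (b, b^2] carries at least 1 / 2 - 5 / ln b >= 1 / 4, and Q takes away at most eta <=
    1 / 8. *)
Local Lemma sg_ge : 1 / 8 <= sg.
Proof.
have lnb' := lnb.
have b1 := b_gt1.
have h2N : b ^+ 2 < N.+1%:R.
  apply: (@le_lt_trans _ _ N%:R); last by rewrite ltr_nat.
  by apply: bX_le_N; rewrite /L; lia.
have h : b <= b ^+ 2 by rewrite expr2; nra.
have := @recip_window R b (b ^+ 2) N b1 h h2N.
rewrite lnXn; last lra.
have -> : (ln b *+ 2 - ln b - 10) / (ln b *+ 2) = 1 / 2 - 5 / ln b.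
  by rewrite -mulr_natr; field; rewrite gt_eqF//; lra.
have h5 : 5 / ln b <= 1 / 4 by rewrite ler_pdivrMr; lra.
rewrite (bigID Q)/= => h3.
have h4 : \sum_(0 <= p < N.+1 | prime p && (b < p%:R <= b ^+ 2) && Q p) p%:R^-1 <= eta :> R.
  apply: le_trans share; rewrite big_mkcond [leRHS]big_mkcond; apply: ler_sum => p _.
  case: ifPn => [/andP[/andP[-> /andP[-> pb]] ->]|_].
    rewrite /= ifT//; apply: le_trans pb _.
    by rewrite ler_weXn2l// ltW.
  by case: ifP => // _; rewrite invr_ge0.
have -> : sg = \sum_(0 <= p < N.+1 | prime p && (b < p%:R <= b ^+ 2) && ~~ Q p) p%:R^-1.
  by apply: eq_bigl => p; rewrite /I -andbA; congr (_ && _); rewrite andbC.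
move: h3 h4; set A := \sum_(_ <= _ < _ | _) _; set B := \sum_(_ <= _ < _ | _) _; move: eta8; lra.
Qed.

Local Lemma sg_gt0 : 0 < sg. Proof. by have := sg_ge; lra. Qed.

(* The measure giving mass [1 / n] to each sifted [n <= sqrt N] is transported [j] times by
   [n -> n p], where the prime [p] in [I] is drawn with probability proportional to [1 / p];
   [walk j n] is [n] times the mass at [n] after [j] steps. *)
Fixpoint walk (j n : nat) : R :=
  if j is j'.+1 then sg^-1 * \sum_(0 <= p < N.+1 | I p && (p %| n)%N) walk j' (n %/ p)
  else (sifted Q n && (n%:R <= b ^+ (2 * s)))%:R.

Local Lemma walk_ge0 j n : 0 <= walk j n.
Proof.
elim: j n => [|j IH] n /=; first exact: ler0n.
by rewrite mulr_ge0 ?invr_ge0 ?(ltW sg_gt0)// sumr_ge0.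
Qed.

Local Lemma walk_sifted j n : ~~ sifted Q n -> walk j n = 0.
Proof.
elim: j n => [|j IH] n /= Sn; first by rewrite (negbTE Sn).
rewrite big1 ?mulr0// => p /andP[Ip pn]; apply: IH; apply: contra Sn => Sn.
by rewrite -(divnK pn) siftedM ?(I_prime _ Ip)// Sn; case/and3P: Ip.
Qed.

Local Lemma walk0 j : walk j 0 = 0. Proof. exact: walk_sifted. Qed.

Local Lemma walk_small j n : n%:R < b ^+ j -> walk j n = 0.
Proof.
elim: j n => [|j IH] n /= h.
  by case: n h => [|n] //; rewrite expr0 ltrn1.
rewrite big1 ?mulr0// => p /andP[Ip pn]; apply: IH.
move: h; rewrite -{1}(divnK pn) natrM exprSr => h.
have b1 := b_gt1.
rewrite ltNge; apply/negP => h'; move: h; rewrite ltNge => /negP; apply.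
case/and3P: Ip => _ _ /andP[bp _].
by apply: ler_pM => //; rewrite ?exprn_ge0//; lra.
Qed.

(** A step preserves the bound: the multiples of p up to t come from the integers up to t / p, and
    the sum of t / (p sg) over the admissible p is t. So [walk] is at most 1 on average, although
    [walk_le] allows large single values. *)
Local Lemma sum_walk_le j t : \sum_(0 <= n < t.+1) walk j n <= t%:R.
Proof.
elim: j t => [|j IH] t /=.
  rewrite big_nat_recl//= add0r.
  apply: (@le_trans _ _ (\sum_(0 <= i < t) 1)).
    by apply: ler_sum => i _; rewrite lern1 leq_b1.
  by rewrite sumr_const_nat subn0.
rewrite -mulr_sumr exchange_sum_multiples; last exact: I_gt0.
rewrite mulrC ler_pdivrMr ?sg_gt0// mulr_sumr.
apply: ler_sum => p /I_gt0 p0.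
under eq_bigr do rewrite mulnK//.
apply: le_trans (IH _) _.
by rewrite ler_pdivlMr ?ltr0n// -natrM ler_nat leq_trunc_div.
Qed.

Local Lemma num_large_primes n (P : pred nat) : (0 < n <= N)%N ->
  (forall p, P p -> prime p && (b < p%:R)) ->
  \sum_(0 <= p < N.+1 | P p && (p %| n)%N) (1 : R) <= L%:R.
Proof.
move=> /andP[n0 nN] hP.
rewrite -big_filter big_const_seq count_predT iter_addr_0.
set r := [seq i <- index_iota 0 N.+1 | P i && (i %| n)%N].
rewrite ler_nat leqNgt; apply/negP => h.
have b1 := b_gt1.
have hr p : p \in r -> (p %| n)%N /\ b <= p%:R.
  by rewrite mem_filter => /andP[/andP[/hP/andP[_ /ltW bp] pn] _].
have := @prime_list_exp_le R b r n; rewrite filter_uniq ?iota_uniq//.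
move=> /(_ _ _ _ hr n0); have -> : all prime r.
  by apply/allP => p; rewrite mem_filter => /andP[/andP[/hP/andP[]]].
have -> : 0 <= b by lra.
move=> /(_ isT isT isT); apply/negP; rewrite -ltNge.
apply: (@le_lt_trans _ _ (b ^+ L)); first by rewrite bN ler_nat.
by rewrite ltr_eXn2l.
Qed.

(** At each step n has at most L predecessors n / p, each weighted by 1 / sg <= 8. *)
Local Lemma walk_le j n : (n <= N)%N -> walk j n <= (8 * L%:R) ^+ j.
Proof.
elim: j n => [|j IH] n nN /=; first by rewrite expr0 lern1 leq_b1.
have [->|n0] := posnP n.
  rewrite big1 ?mulr0 ?exprn_ge0// => p _; by rewrite div0n walk0.
apply: (@le_trans _ _ (sg^-1 * (L%:R * (8 * L%:R) ^+ j))).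
  rewrite ler_wpM2l ?invr_ge0 ?(ltW sg_gt0)//.
  apply: (@le_trans _ _ (\sum_(0 <= p < N.+1 | I p && (p %| n)%N) 1 * (8 * L%:R) ^+ j)).
    apply: ler_sum => p _; rewrite mul1r IH// (leq_trans _ nN)// leq_div//.
  rewrite -mulr_suml ler_wpM2r ?exprn_ge0//.
  by apply: num_large_primes; rewrite ?n0// => p /and3P[-> _ /andP[]].
rewrite exprS mulrA ler_wpM2r ?exprn_ge0// ler_wpM2r//.
by rewrite -[leLHS]mul1r ler_pdivrMr ?sg_gt0//; have := sg_ge; lra.
Qed.

Let Z := Num.truncn (N%:R / b ^+ 4).
Let Y := Num.truncn (N%:R / b ^+ 2).
Let mass j : R := \sum_(0 <= n < Z.+1) walk j n / n%:R.
Let wmass j : R := \sum_(Z.+1 <= n < Y.+1) walk j n / n%:R.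

Local Lemma bX_gt0 m : 0 < b ^+ m. Proof. by rewrite exprn_gt0//; have := b_gt1; lra. Qed.

Local Lemma le_Z n : (n <= Z)%N = (n%:R * b ^+ 4 <= N%:R).
Proof. by rewrite truncn_ge_nat ?divr_ge0 ?(ltW (bX_gt0 _))// ler_pdivlMr ?bX_gt0. Qed.

Local Lemma le_Y n : (n <= Y)%N = (n%:R * b ^+ 2 <= N%:R).
Proof. by rewrite truncn_ge_nat ?divr_ge0 ?(ltW (bX_gt0 _))// ler_pdivlMr ?bX_gt0. Qed.

Local Lemma le_ZY : (Z <= Y)%N.
Proof.
rewrite le_Y; have : (Z <= Z)%N by []; rewrite le_Z; apply: le_trans.
by rewrite ler_wpM2l// ler_weXn2l// ltW// b_gt1.
Qed.

(** A step multiplies by at most b^2, so it cannot carry mass from below Z beyond Y: the window (Z,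
    Y] is never jumped over. *)
Local Lemma mass_step j : mass j <= mass j.+1 + wmass j.+1.
Proof.
have -> : mass j.+1 + wmass j.+1 = \sum_(0 <= n < Y.+1) walk j.+1 n / n%:R.
  by rewrite [RHS](@big_cat_nat _ _ _ Z.+1)//= ltnS le_ZY.
rewrite /=; under eq_bigr do rewrite -mulrA mulr_suml.
rewrite -mulr_sumr (exchange_sum_multiples _ _ _ _ (fun p n => walk j (n %/ p) / n%:R)); last
  exact: I_gt0.
rewrite mulrC ler_pdivlMr ?sg_gt0// mulr_sumr; apply: ler_sum => p Ip.
have p0 := I_gt0 _ Ip.
rewrite /mass mulr_suml.
apply: (@le_trans _ _ (\sum_(0 <= m < Z.+1) walk j (m * p %/ p) / (m * p)%:R)).
  apply: ler_sum => m _; rewrite mulnK// natrM invfM -!mulrA.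
  by rewrite [m%:R^-1 * _]mulrC.
have ZY : (Z <= Y %/ p)%N.
  rewrite leq_divRL// le_Y natrM.
  have : (Z <= Z)%N by []; rewrite le_Z; apply: le_trans.
  rewrite -mulrA ler_wpM2l//.
  case/and3P: Ip => _ _ /andP[_ h]; have := bX_gt0 2.
  rewrite (_ : b ^+ 4 = b ^+ 2 * b ^+ 2); last by rewrite -exprD.
  by move=> h2; rewrite ler_wpM2r// ltW.
rewrite [leRHS](@big_cat_nat _ _ _ Z.+1)//=.
by rewrite lerDl sumr_ge0// => m _; rewrite divr_ge0 ?walk_ge0.
Qed.

Local Lemma mass_wmass J : mass 0 <= mass J + \sum_(0 <= j < J) wmass j.+1.
Proof.
elim: J => [|J IH]; first by rewrite big_geq// addr0.
rewrite big_nat_recr//=; have := mass_step J; move: IH.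
by set S := \sum_(_ <= _ < _) _; lra.
Qed.

(** Apply [harmonic_sifted] up to the integer part of b^(2 s), which is below Z as s >= 2. The term
    - c1 pays for the rounding, since ln 2 <= 1. *)
Local Lemma mass0_ge : c1 * (2 * s%:R * ln b) - c1 <= mass 0.
Proof.
have b1 := b_gt1.
pose z := Num.truncn (b ^+ (2 * s)).
have hz : (z%:R <= b ^+ (2 * s)) by rewrite truncn_le ltW// bX_gt0.
have z1 : (0 < z)%N by rewrite truncn_gt0 exprn_ege1// ltW.
have zN : (z <= N)%N by rewrite -(ler_nat R) (le_trans hz)// bX_le_N// /L; lia.
have zZ : (z <= Z)%N.
  rewrite le_Z (le_trans (ler_wpM2r (ltW (bX_gt0 4)) hz))// -exprD bX_le_N// /L; lia.
have := @harmonic_sifted R Q z C.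
have hz' : \sum_(0 <= q < z.+1 | prime q && Q q) q%:R^-1 <= C.
  apply: le_trans hC; rewrite [leRHS](@big_cat_nat _ _ _ z.+1)//=.
  by rewrite lerDl sumr_ge0// => m _; rewrite invr_ge0.
move=> /(_ hz') h.
have h2 : 2 * s%:R * ln b - 1 <= ln z%:R.
  have -> : 2 * s%:R * ln b = ln (b ^+ (2 * s)).
    rewrite lnXn; last lra.
    by rewrite -(mulr_natr (ln b)) natrM mulrC.
  have h3 : b ^+ (2 * s) <= z%:R * 2.
    have := truncnS_gt (b ^+ (2 * s)); rewrite -natr1.
    have : (1 : R) <= z%:R by rewrite ler1n.
    by rewrite -/z; lra.
  have : ln (b ^+ (2 * s)) <= ln (z%:R * 2).
    by rewrite ler_ln ?posrE ?mulr_gt0 ?bX_gt0 ?ltr0n.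
  rewrite lnM ?posrE ?ltr0n//.
  have : ln (1 + 1) <= 1 by apply: le_ln1Dx; lra.
  by rewrite -[2%:R]/(1 + 1); lra.
apply: (@le_trans _ _ (c1 * ln z%:R)).
  by rewrite -{2}[c1]mulr1 -mulrBr ler_wpM2l// expR_ge0.
apply: le_trans h _.
rewrite /mass [leRHS](@big_cat_nat _ _ _ z.+1)//=.
rewrite ler_wpDr ?sumr_ge0//.
rewrite big_mkcond big_nat_cond [leRHS]big_nat_cond.
apply: ler_sum => n /andP[/andP[_ nz] _].
case: ifPn => Sn /=; last by rewrite divr_ge0.
by rewrite (le_trans _ hz) ?ler_nat// mul1r.
Qed.

(** Counts the primes that complete n to a product in (N / K, N]. *)
Let cnt (P : pred nat) (n : nat) : R :=
  \sum_(0 <= p < N.+1 | [&& prime p, P p & N%:R / n%:R / K < p%:R <= (N%:R / n%:R : R)]) 1.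

Local Lemma window_range n : (Z < n <= Y)%N -> (0 < n)%N /\ b ^+ 2 <= N%:R / n%:R < b ^+ 4.
Proof.
move=> /andP[Zn nY]; have n0 : (0 < n)%N by lia.
split=> //; rewrite ler_pdivlMr ?ltr_pdivrMr ?ltr0n//.
move: Zn nY; rewrite ltnNge le_Z le_Y -ltNge => h1 h2.
by rewrite mulrC h2 mulrC.
Qed.

Local Lemma cnt_ge n : (Z < n <= Y)%N ->
  N%:R / (4 * K * ln b) / n%:R <= cnt predT n.
Proof.
have lnb' := lnb.
move=> /window_range[n0 /andP[h1 h2]].
have b1 := b_gt1; have b2 := b_gt; have K1 := K_gt1.
have n1 : (1 : R) <= n%:R by rewrite ler1n.
have N0 : (0 : R) < N%:R by rewrite ltr0n N_gt0.
set t := N%:R / n%:R in h1 h2 *.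
have tb : b <= t by apply: le_trans h1; rewrite expr2; nra.
have tN : t < N.+1%:R.
  apply: (@le_lt_trans _ _ N%:R); last by rewrite ltr_nat.
  by rewrite ler_pdivrMr; nra.
have tK : K <= t by lra.
apply: le_trans (@prime_count_window R t N tK tN).
have t0 : 0 < t by lra.
have lt : ln t <= 4 * ln b.
  have : ln t <= ln (b ^+ 4) by rewrite ler_ln ?posrE ?bX_gt0// ltW.
  rewrite lnXn; last lra.
  by rewrite -(mulr_natr (ln b)); lra.
have lt0 : 0 < ln t by rewrite ln_gt0//; lra.
rewrite mulrAC -/t ler_wpM2l ?(ltW t0)//.
rewrite -/K lef_pV2 ?posrE ?mulr_gt0//; try lra.
rewrite -mulrA [leRHS]mulrCA ler_wpM2l//; lra.
Qed.

(** Since b^2 <= N / n < b^4 and K < b, each prime counted lies in the window (b, b^4] where Q has a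
    small share. After exchanging the sums, q collects the [walk] of the n <= N / q, at most N / q
    by [sum_walk_le]. *)
Local Lemma cntQ_le j :
  \sum_(Z.+1 <= n < Y.+1) walk j n * cnt Q n <= eta * N%:R.
Proof.
have b1 := b_gt1; have b2 := b_gt; have K1 := K_gt1.
pose D q := [&& prime q, Q q & b < q%:R <= b ^+ 4].
apply: (@le_trans _ _ (\sum_(Z.+1 <= n < Y.+1) \sum_(0 <= q < N.+1 | D q && (n <= N %/ q)%N) walk j n)).
  rewrite big_nat_cond [leRHS]big_nat_cond; apply: ler_sum => n /andP[hn _].
  have [n0 /andP[h1 h2]] := window_range _ hn.
  rewrite mulr_sumr big_mkcond [leRHS]big_mkcond; apply: ler_sum => q _.
  rewrite mulr1; case: ifPn => [/and3P[pq Qq /andP[q1 q2]]|_]; last by case: ifP; rewrite // walk_ge0.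
  rewrite ifT// /D pq Qq/=.
  have -> : q%:R <= b ^+ 4 by apply: le_trans q2 (ltW h2).
  have -> : b < q%:R.
    apply: le_lt_trans q1; rewrite ler_pdivlMr; last lra.
    by apply: le_trans h1; rewrite expr2 ler_wpM2l//; lra.
  rewrite leq_divRL ?prime_gt0//=.
  by move: q2; rewrite ler_pdivlMr ?ltr0n// -natrM ler_nat mulnC.
under eq_bigr do rewrite big_mkcondr/=.
rewrite exchange_big/= mulrC.
apply: le_trans (ler_wpM2l (ler0n _ N) share).
rewrite mulr_sumr; apply: ler_sum => q /and3P[pq _ _].
apply: (@le_trans _ _ (\sum_(0 <= n < (N %/ q).+1) walk j n)); last first.
  apply: le_trans (sum_walk_le _ _) _.
  by rewrite ler_pdivlMr ?ltr0n ?prime_gt0// -natrM ler_nat leq_trunc_div.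
rewrite -big_mkcond.
have -> : \sum_(Z.+1 <= i < Y.+1 | (i <= N %/ q)%N) walk j i =
  \sum_(0 <= i < Y.+1 | (Z < i <= N %/ q)%N) walk j i.
  rewrite [RHS](@big_cat_nat _ _ _ Z.+1)//= ?ltnS ?le_ZY//.
  rewrite [X in _ = X + _]big_nat_cond [X in _ = X + _]big1 ?add0r.
    by rewrite big_nat_cond [RHS]big_nat_cond; apply: eq_bigl => i; case: ltnP.
  by move=> i; lia.
pose M := (maxn (Y.+1) (N %/ q).+1).
rewrite (big_nat_widen _ _ M) ?leq_maxl// [leRHS](big_nat_widen _ _ M) ?leq_maxr//.
rewrite big_mkcond [leRHS]big_mkcond; apply: ler_sum => i _.
case: ifPn => [/andP[/andP[_ h] _]|_]; first by rewrite ltnS h.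
by case: ifP; rewrite // walk_ge0.
Qed.

(** The products n p with [walk j n] nonzero are sifted integers up to N. Each arises from at most L
    primes p, with weight at most (8 L)^L. *)
Local Lemma cntNQ_le j : (j <= L)%N ->
  \sum_(Z.+1 <= n < Y.+1) walk j n * cnt (fun p => ~~ Q p) n <=
  L%:R * (8 * L%:R) ^+ L * \sum_(0 <= n < N.+1 | sifted Q n) 1.
Proof.
move=> jL; have b1 := b_gt1; have b2 := b_gt; have K1 := K_gt1.
have L1 : (1 : R) <= L%:R by rewrite ler1n /L; lia.
pose D q := [&& prime q, ~~ Q q & b < q%:R].
apply: (@le_trans _ _ (\sum_(0 <= p < N.+1 | D p) \sum_(0 <= n < (N %/ p).+1) walk j n)).
  have YN : (Y <= N)%N.
    have : (Y <= Y)%N by []; rewrite le_Y -(ler_nat R); apply: le_trans.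
    by rewrite ler_peMr// exprn_ege1// ltW.
  rewrite [leRHS](eq_bigr (fun p => \sum_(0 <= n < N.+1 | (n <= N %/ p)%N) walk j n)); last first.
    by move=> p _; rewrite (big_nat_widen _ _ N.+1)// ltnS leq_div.
  under [leRHS]eq_bigr do rewrite big_mkcond/=.
  rewrite exchange_big/=.
  apply: (@le_trans _ _ (\sum_(Z.+1 <= n < Y.+1) \sum_(0 <= p < N.+1 | D p) (if (n <= N %/ p)%N
    then walk j n else 0))); last first.
    rewrite [leRHS](@big_cat_nat _ _ _ Z.+1)//=; last by rewrite ltnS (leq_trans le_ZY).
    rewrite [X in _ <= _ + X](@big_cat_nat _ _ _ Y.+1)//= ?ltnS ?le_ZY//.
    rewrite ler_wpDl// ?ler_wpDr// sumr_ge0// => n _; rewrite sumr_ge0// => p _;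
      by case: ifP; rewrite // walk_ge0.
  rewrite big_nat_cond [leRHS]big_nat_cond; apply: ler_sum => n /andP[hn _].
  have [n0 /andP[h1 h2]] := window_range _ hn.
  rewrite mulr_sumr big_mkcond [leRHS]big_mkcond; apply: ler_sum => q _.
  rewrite mulr1; case: ifPn => [/and3P[pq Qq /andP[q1 q2]]|_]; last first.
    by do 2!(case: ifP => //= _); rewrite // walk_ge0.
  rewrite /D pq Qq/=.
  have -> : b < q%:R.
    apply: le_lt_trans q1; rewrite ler_pdivlMr; last lra.
    by apply: le_trans h1; rewrite expr2 ler_wpM2l//; lra.
  rewrite leq_divRL ?prime_gt0//=.
  by move: q2; rewrite ler_pdivlMr ?ltr0n// -natrM ler_nat mulnC => ->.
rewrite -[leLHS](@eq_bigr _ _ _ _ _ _ (fun p => \sum_(0 <= m < (N %/ p).+1) walk j (m * p %/ p)));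
  last first.
  move=> p /and3P[pp _ _]; apply: eq_bigr => m _; by rewrite mulnK ?prime_gt0.
rewrite -(exchange_sum_multiples _ _ _ _ (fun p n => walk j (n %/ p))); last first.
  by move=> q /and3P[/prime_gt0].
rewrite mulr_sumr [leRHS]big_mkcond [leLHS]big_nat_cond [leRHS]big_nat_cond.
apply: ler_sum => n /andP[/andP[_ nN] _].
case: ifPn => Sn; last first.
  rewrite big1// => p /andP[/and3P[pp Qp _] pn]; apply: walk_sifted.
  by move: Sn; rewrite -{1}(divnK pn) siftedM// Qp andbT.
rewrite mulr1.
apply: (@le_trans _ _ (\sum_(0 <= p < N.+1 | D p && (p %| n)%N) 1 * (8 * L%:R) ^+ L)).
  apply: ler_sum => p _; rewrite mul1r.
  apply: (@le_trans _ _ ((8 * L%:R) ^+ j)); last by rewrite ler_weXn2l//; lra.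
  by rewrite walk_le// (leq_trans (leq_div _ _))//.
rewrite -mulr_suml ler_wpM2r ?exprn_ge0//.
apply: num_large_primes; last by move=> p /and3P[-> _ ->].
by case/siftedP: Sn => ->.
Qed.

Lemma sifted_count_core :
  c1 / (16 * K * L%:R ^+ 2 * (8 * L%:R) ^+ L) * N%:R <=
  \sum_(0 <= n < N.+1 | sifted Q n) 1.
Proof.
have lnb' := lnb.
have b1 := b_gt1; have b2 := b_gt; have K1 := K_gt1.
have c0 : 0 < c1 by exact: expR_gt0.
have L1 : (8 : R) <= L%:R by rewrite ler_nat /L; lia.
have N0 : (0 : R) < N%:R by rewrite ltr0n N_gt0.
have s2' : (2 : R) <= s%:R by rewrite ler_nat.
have Ls : L%:R = 4 * s%:R :> R by rewrite natrM.
pose G := \sum_(0 <= j < L) \sum_(Z.+1 <= n < Y.+1) walk j.+1 n * cnt (fun p => ~~ Q p) n.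
have G_le : G <= L%:R * (L%:R * (8 * L%:R) ^+ L * \sum_(0 <= n < N.+1 | sifted Q n) 1).
  rewrite /G big_nat_cond.
  apply: (@le_trans _ _ (\sum_(0 <= j < L | (0 <= j < L)%N && true) (L%:R * (8 * L%:R) ^+ L *
    \sum_(0 <= n < N.+1 | sifted Q n) 1))).
    by apply: ler_sum => j /andP[/andP[_ jL] _]; apply: cntNQ_le.
  by rewrite -big_nat_cond sumr_const_nat subn0 -[leLHS]mulr_natl.
(* After L steps every n in the support is at least b^L = N, beyond Z, so the whole initial mass has
   passed through the window. *)
have massL : mass L = 0.
  rewrite /mass big_nat_cond big1// => n /andP[/andP[_ nZ] _].
  rewrite walk_small ?mul0r// bN.
  have : (n <= Z)%N by []; rewrite le_Z.
  have [->|n0] := posnP n; first by rewrite N0.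
  apply: lt_le_trans; rewrite ltr_pMr ?ltr0n//.
  by rewrite exprn_egt1.
have G_ge : N%:R / (4 * K * ln b) * mass 0 - L%:R * (eta * N%:R) <= G.
  rewrite lerBlDr.
  have -> : L%:R * (eta * N%:R) = \sum_(0 <= j < L) (eta * N%:R).
    by rewrite sumr_const_nat subn0 -[RHS]mulr_natl.
  rewrite -big_split/=.
  apply: (@le_trans _ _ (N%:R / (4 * K * ln b) * \sum_(0 <= j < L) wmass j.+1)).
    rewrite ler_wpM2l//.
      by rewrite divr_ge0// !mulr_ge0//; lra.
    by have := mass_wmass L; rewrite massL add0r.
  rewrite mulr_sumr; apply: ler_sum => j _.
  apply: (@le_trans _ _ (\sum_(Z.+1 <= n < Y.+1) walk j.+1 n * cnt predT n)).
    rewrite /wmass mulr_sumr big_nat_cond [leRHS]big_nat_cond; apply: ler_sum => n /andP[hn _].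
    rewrite mulrCA ler_wpM2l ?walk_ge0//; exact: cnt_ge.
  apply: le_trans (lerD (lexx _) (cntQ_le j.+1)).
  rewrite -big_split/=; apply: ler_sum => n _.
  rewrite -mulrDr; apply: ler_wpM2l; [exact: (walk_ge0 j.+1 n)|].
  rewrite /cnt (bigID Q)/= addrC.
  apply: lerD; rewrite le_eqVlt; apply/orP; left; apply/eqP; apply: eq_bigl => p;
    by rewrite -!andbA; congr (_ && _); rewrite [RHS]andbC -andbA.
have h1 := mass0_ge.
have h2 : N%:R * c1 * s%:R / (16 * K) <= G.
  apply: le_trans G_ge.
  have lb : 0 < ln b by lra.
  have h3 : N%:R / (4 * K * ln b) * (c1 * (2 * s%:R * ln b) - c1) <= N%:R / (4 * K * ln b) * mass 0.
    by rewrite ler_wpM2l// divr_ge0// !mulr_ge0//; lra.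
  apply: le_trans (lerB h3 (lexx _)).
  rewrite Ls /eta -subr_ge0.
  have -> : N%:R / (4 * K * ln b) * (c1 * (2 * s%:R * ln b) - c1) -
   4 * s%:R * (c1 / (16 * K) * N%:R) - N%:R * c1 * s%:R / (16 * K) =
   N%:R * c1 / (4 * K) * (3 / 4 * s%:R - (ln b)^-1).
    by field; apply/andP; split; rewrite gt_eqF//; lra.
  rewrite mulr_ge0 ?divr_ge0 ?mulr_ge0//; try lra.
  have : (ln b)^-1 <= 1 by rewrite invf_le1//; lra.
  lra.
set P8 := (8 * L%:R) ^+ L in G_le *.
have P8_0 : 0 < P8 by rewrite exprn_gt0//; lra.
set S := \sum_(_ <= _ < _ | _) _ in G_le *.
have h : N%:R * c1 / (16 * K) <= L%:R * (L%:R * P8 * S).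
  apply: le_trans G_le; apply: le_trans h2.
  rewrite ler_wpM2r ?invr_ge0//; first lra.
  by rewrite ler_peMr ?mulr_ge0//; lra.
rewrite (_ : c1 / (16 * K * L%:R ^+ 2 * P8) * N%:R = N%:R * c1 / (16 * K) / (L%:R ^+ 2 * P8)); last
  first.
  field; rewrite !gt_eqF//; lra.
rewrite ler_pdivrMr; last by rewrite mulr_gt0// exprn_gt0//; lra.
by rewrite [leRHS](_ : _ = L%:R * (L%:R * P8 * S))//; ring.
Qed.

End Core.

(** * Choice of the window and uniform lower bound for sifted integers *)

Section LowerBound.
Variable R : realType.
Local Notation ln := (@ln R).

(** Otherwise the J disjoint windows would together carry more than J eta > C. *)
Lemma low_share_window (Q : pred nat) (N J : nat) (b : nat -> R) (C eta : R) :
  (forall i, b i.+1 <= b i) ->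
  \sum_(0 <= q < N.+1 | prime q && Q q) q%:R^-1 <= C -> C < J%:R * eta ->
  exists2 i, (i < J)%N &
   \sum_(0 <= q < N.+1 | [&& prime q, Q q & b i.+1 < q%:R <= b i]) q%:R^-1 <= eta.
Proof.
move=> bS hC CJ.
pose sh i := \sum_(0 <= q < N.+1 | [&& prime q, Q q & b i.+1 < q%:R <= b i]) (q%:R^-1 : R).
have [|h] := pselect (exists2 i, (i < J)%N & sh i <= eta); first by [].
exfalso.
pose f i := \sum_(0 <= q < N.+1 | [&& prime q, Q q & q%:R <= b i]) (q%:R^-1 : R).
have fS i : f i = f i.+1 + sh i.
  rewrite /f (bigID (fun q => q%:R <= b i.+1))/=; congr (_ + _); apply: eq_bigl => q.
    rewrite -!andbA; do 2!congr (_ && _).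
    case: (lerP q%:R (b i.+1)) => qb; rewrite ?andbF ?andbT//.
    exact: le_trans (bS i).
  by rewrite -!andbA -ltNge; do 2!congr (_ && _); rewrite andbC.
have f0 i : 0 <= f i by rewrite sumr_ge0// => q _; rewrite invr_ge0.
have tel j : (j <= J)%N -> j%:R * eta <= f 0 - f j.
  elim: j => [|j IH] jJ; first by rewrite mul0r subrr.
  have := IH (ltnW jJ); rewrite (fS j) -natr1.
  have : eta < sh j by rewrite ltNge; apply/negP => hj; apply: h; exists j.
  by lra.
have := tel J (leqnn _); have := f0 J.
have : f 0 <= C.
  apply: le_trans hC; rewrite /f big_mkcond [leRHS]big_mkcond; apply: ler_sum => q _.
  case: ifPn => [/and3P[-> -> _]//|_]; by case: ifP; rewrite // invr_ge0.
lra.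
Qed.

(** The pigeonhole does not tell which window it selects, hence only bounds L; the final constant
    has to serve all windows. *)
Lemma core_const_mono (c K : R) (L M : nat) : 0 <= c -> 0 < K -> (0 < L)%N -> (L <= M)%N ->
  c / (16 * K * M%:R ^+ 2 * (8 * M%:R) ^+ M) <= c / (16 * K * L%:R ^+ 2 * (8 * L%:R) ^+ L).
Proof.
move=> c0 K0 L0 LM; rewrite ler_wpM2l//.
have L1 : (1 : R) <= L%:R by rewrite ler1n.
have {}LM' : (L%:R : R) <= M%:R by rewrite ler_nat.
have M1 := le_trans L1 LM'.
have h (n : nat) (y : R) : 1 <= y -> 0 < 16 * K * y ^+ 2 * (8 * y) ^+ n.
  by move=> y1; rewrite !mulr_gt0 ?exprn_gt0 ?mulr_gt0//; lra.
rewrite lef_pV2 ?posrE ?h//.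
have h8 : 1 <= 8 * M%:R :> R by lra.
have l0 : 0 <= 8 * L%:R :> R by lra.
have m0 : 0 <= 8 * M%:R :> R by lra.
have lm : 8 * L%:R <= 8 * M%:R :> R by lra.
have K16 := ltW K0.
apply: ler_pM; rewrite ?mulr_ge0 ?exprn_ge0//.
  by rewrite ler_wpM2l ?mulr_ge0// lerXn2r// nnegrE.
apply: (@le_trans _ _ ((8 * M%:R) ^+ L)); first by rewrite lerXn2r.
exact: ler_weXn2l.
Qed.

Lemma sifted_lower_bound (C : R) : exists2 c : R, 0 < c & exists N0 : nat,
  forall (N : nat) (Q : pred nat), (N0 <= N)%N ->
  \sum_(0 <= q < N.+1 | prime q && Q q) q%:R^-1 <= C ->
  c * N%:R <= \sum_(0 <= n < N.+1 | sifted Q n) 1.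
Proof.
have [C0|C0] := ltP C 0.
  exists 1 => //; exists 0%N => N Q _ h; exfalso.
  have : 0 <= \sum_(0 <= q < N.+1 | prime q && Q q) (q%:R^-1 : R).
    by rewrite sumr_ge0// => q _; rewrite invr_ge0.
  by lra.
pose K := expR (11 : R); pose c1 := expR (- (2 * C)); pose eta := c1 / (16 * K).
have K1 : 1 < K by rewrite expR_gt1; lra.
have c10 : 0 < c1 by exact: expR_gt0.
have c11 : c1 <= 1 by rewrite /c1 expR_le1; lra.
have eta0 : 0 < eta by rewrite divr_gt0// mulr_gt0//; lra.
have eta8 : eta <= 1 / 8 by rewrite ler_pdivrMr; lra.
pose J := (Num.truncn (C / eta)).+1.
have CJ : C < J%:R * eta by rewrite -ltr_pdivrMr// truncnS_gt.
pose M := (4 * 4 ^ J)%N.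
exists (c1 / (16 * K * M%:R ^+ 2 * (8 * M%:R) ^+ M)).
  have M0 : (0 : R) < M%:R by rewrite ltr0n /M muln_gt0 expn_gt0.
  by rewrite divr_gt0// !mulr_gt0// ?exprn_gt0// ?mulr_gt0//; lra.
(* Ensures ln b >= 20 for every candidate b = N^(1 / 4^(i+2)), because 4^(i+2) <= M when i < J. *)
exists (Num.truncn (expR (20 * M%:R : R))).+1 => N Q hN hQ.
have N0 : (0 : R) < N%:R by rewrite ltr0n; lia.
have lnN : 20 * M%:R <= ln N%:R.
  rewrite -ler_expR lnK ?posrE// ltW//.
  apply: lt_le_trans (truncnS_gt _) _; by rewrite ler_nat.
have N1 : (1 : R) <= N%:R by rewrite ler1n -(ltr0n R).
pose b i := (N%:R : R) `^ ((4 ^ i)%:R^-1).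
have bS i : b i.+1 <= b i.
  rewrite ler_powR// lef_pV2 ?posrE ?ltr0n ?expn_gt0// ler_nat leq_pexp2l//.
(* The highest window ends at N^(1/4), not at N, so that s = 4^(i+1) >= 2. *)
have [i iJ share] := @low_share_window Q N J (fun i => b i.+1) C eta (fun i => bS i.+1) hQ CJ.
have bX j m : b j ^+ m = N%:R `^ ((4 ^ j)%:R^-1 * m%:R).
  by rewrite powRrM powR_mulrn// powR_ge0.
have b4 : b i.+2 ^+ 4 = b i.+1.
  rewrite bX; congr (_ `^ _); rewrite (expnS _ i.+1) natrM.
  have : (0 : R) < (4 ^ i.+1)%:R by rewrite ltr0n expn_gt0.
  by move=> h; field; rewrite gt_eqF.
rewrite -b4 in share.
have s2 : (2 <= 4 ^ i.+1)%N.
  apply: (@leq_trans (4 ^ 1)) => //; exact: leq_pexp2l.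
have bN : b i.+2 ^+ (4 * 4 ^ i.+1) = N%:R.
  rewrite -expnS bX mulVf ?powRr1//.
have lb : 20 <= ln (b i.+2).
  rewrite ln_powR mulrC ler_pdivlMr ?ltr0n ?expn_gt0//.
  apply: le_trans lnN; rewrite ler_wpM2l// ler_nat /M -expnS leq_pexp2l//.
have := @sifted_count_core R N (4 ^ i.+1) (b i.+2) Q C s2 bN lb hQ eta8 share.
apply: le_trans; rewrite ler_wpM2r// -/c1.
apply: core_const_mono => //; first exact: ltW.
- exact: lt_trans K1.
- by rewrite muln_gt0 expn_gt0.
- by rewrite /M leq_pmul2l// leq_pexp2l.
Qed.

End LowerBound.

(** * Bonferroni inequality and sets of primes *)

Section SubsetSums.
Import fintype finset.
Local Open Scope set_scope.
Variables (R : realType) (T : finType).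
Implicit Types (A B X : {set T}) (f : T -> R).

Lemma sum_subset_prod X f :
  \sum_(A : {set T} | A \subset X) \prod_(q in A) f q = \prod_(q in X) (1 + f q).
Proof.
rewrite [RHS]big_mkcond/=.
rewrite (eq_bigr (fun q => (if q \in X then f q else 0) + 1)); last first.
  by move=> q _; case: ifP => _; rewrite ?add0r// addrC.
rewrite bigA_distr/= [LHS]big_mkcond; apply: eq_bigr => A _.
rewrite -big_mkcond/=; case: ifPn => [AX|].
  by apply: eq_bigr => q qA; rewrite (subsetP AX).
case/subsetPn => q qA qX.
by rewrite (bigD1 q)//= (negbTE qX) mul0r.
Qed.

Lemma prod_1D_le_expR X f : (forall q, q \in X -> 0 <= f q) ->
  \prod_(q in X) (1 + f q) <= expR (\sum_(q in X) f q).
Proof.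
move=> f0; rewrite expR_sum; apply: ler_prod => q qX.
by rewrite expR_ge1Dx addr_ge0 ?f0.
Qed.

Lemma sum_subset_pow_le X f (t : R) : 0 <= t -> (forall q, q \in X -> 0 <= f q) ->
  \sum_(A : {set T} | A \subset X) t ^+ #|A| * \prod_(q in A) f q <=
  expR (t * \sum_(q in X) f q).
Proof.
move=> t0 f0; rewrite mulr_sumr.
rewrite (eq_bigr (fun A : {set T} => \prod_(q in A) (t * f q))); last first.
  by move=> A _; rewrite big_split/= prodr_const.
rewrite sum_subset_prod; apply: prod_1D_le_expR => q qX.
by rewrite mulr_ge0 ?f0.
Qed.

Lemma alt_bin_sum (f k : nat) :
  \sum_(j < k.+1) (-1) ^+ j * 'C(f.+1, j)%:R = (-1) ^+ k * 'C(f, k)%:R :> R.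
Proof.
elim: k => [|k IH]; first by rewrite big_ord_recr big_ord0/= !bin0 add0r.
by rewrite big_ord_recr/= IH binS natrD exprS; ring.
Qed.

Lemma sum_subset_card X (c : nat -> R) (k : nat) :
  \sum_(A : {set T} | (A \subset X) && (#|A| <= k)%N) c #|A| =
  \sum_(j < k.+1) c j * 'C(#|X|, j)%:R.
Proof.
rewrite (partition_big (fun A : {set T} => inord #|A| : 'I_k.+1) predT)//=.
apply: eq_bigr => j _.
rewrite -(cards_draws X j) -sum1_card natr_sum mulr_sumr.
rewrite (eq_bigl (fun A : {set T} => A \in [set A : {set T} | (A \subset X) & #|A| == j])); last first.
  move=> A; rewrite inE -andbA; congr (_ && _).
  apply/andP/eqP => [[Ak /eqP <-]|Aj]; first by rewrite inordK.
  by rewrite Aj -ltnS ltn_ord; split=> //; apply/eqP; apply: val_inj; rewrite /= inordK.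
by apply: eq_bigr => A; rewrite inE mulr1 => /andP[_ /eqP->].
Qed.

(** If X has f + 1 elements, the alternating sum cut after size k equals (-1)^k C(f, k), and C(f, k)
    <= C(f + 1, k). The error thus involves only sets of size k, no larger than those already in the
    sum. *)
Lemma bonferroni X (k : nat) :
  `|(X == finset.set0)%:R - (\sum_(A : {set T} | (A \subset X) && (#|A| <= k)%N) (-1) ^+ #|A|)|
  <= \sum_(A : {set T} | (A \subset X) && (#|A| == k)) (1 : R).
Proof.
rewrite (sum_subset_card X (fun j => (-1) ^+ j)).
have -> : \sum_(A : {set T} | (A \subset X) && (#|A| == k)) (1 : R) = 'C(#|X|, k)%:R.
  rewrite -(cards_draws X k) -sum1_card natr_sum; apply: eq_bigl => A; by rewrite inE.
rewrite -cards_eq0; case: #|X| => [|f] /=.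
  rewrite big_ord_recl/= bin0 expr0 mulr1 big1 ?addr0 ?subrr ?normr0//.
  by move=> i _; rewrite /bump/= bin_small// mulr0.
rewrite alt_bin_sum sub0r normrN normrM normrX normrN1 expr1n mul1r normr_nat.
by rewrite ler_nat; case: k => [|k]; rewrite ?bin0// binS leq_addr.
Qed.

End SubsetSums.

Section PrimeSets.
Import fintype finset.
Local Open Scope set_scope.
Variable N : nat.
Local Notation T := 'I_N.+1.
Implicit Types (A B X : {set T}).

Definition primeset : {set T} := [set q : T | prime q].

(** Squarefree moduli are represented by their sets of prime factors, so that least common multiples
    become unions. *)
Definition setprod A : nat := (\prod_(q in A) (q : nat))%N.

Definition prime_divs (n : nat) : {set T} := [set q : T | prime q && (q %| n)%N].

Lemma setprodE A : setprod A = (\prod_(q <- [seq val q | q <- enum A]) q)%N.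
Proof. by rewrite big_map big_enum. Qed.

Lemma uniq_vals A : uniq [seq val q | q <- enum A].
Proof. by rewrite map_inj_uniq ?enum_uniq//; exact: val_inj. Qed.

Lemma prime_vals A : A \subset primeset -> all prime [seq val q | q <- enum A].
Proof.
move=> AP; apply/allP => _ /mapP[q qA ->].
by move: qA; rewrite mem_enum => /(subsetP AP); rewrite inE.
Qed.

Lemma setprod_dvd A n : A \subset primeset -> (setprod A %| n)%N = (A \subset prime_divs n).
Proof.
move=> AP; rewrite setprodE prod_primes_dvd ?uniq_vals ?prime_vals// all_map.
apply/allP/subsetP => h q.
  move=> qA; rewrite inE; apply/andP; split.
    by move/(subsetP AP): qA; rewrite inE.
  by apply: h; rewrite mem_enum.
by rewrite mem_enum => /h; rewrite inE => /andP[].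
Qed.

Lemma setprod_gt0 A : A \subset primeset -> (0 < setprod A)%N.
Proof.
by move=> AP; apply: prodn_cond_gt0 => q /(subsetP AP); rewrite inE => /prime_gt0.
Qed.

Lemma prime_divs_setprod A : A \subset primeset -> prime_divs (setprod A) = A.
Proof.
move=> AP; apply/setP => q; rewrite inE; apply/andP/idP.
  move=> [pq]; rewrite setprodE => /(prime_dvd_prod_primes _ _ pq (prime_vals _ AP)).
  by case/mapP => r rA /val_inj->; move: rA; rewrite mem_enum.
move=> qA; split; first by move/(subsetP AP): qA; rewrite inE.
by rewrite /setprod (bigD1 q)//= dvdn_mulr.
Qed.

Lemma setprodU A B :
  A :&: B = finset.set0 -> setprod (A :|: B) = (setprod A * setprod B)%N.
Proof. move=> AB; rewrite /setprod -bigU/=; first by apply: eq_bigl => q; rewrite !inE.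
by rewrite -finset.setI_eq0 AB.
Qed.

Lemma setprod_sub A B : A \subset B -> B \subset primeset -> (setprod A <= setprod B)%N.
Proof.
move=> AB BP; apply: dvdn_leq; first exact: setprod_gt0.
by rewrite setprod_dvd ?(subset_trans AB)// prime_divs_setprod.
Qed.

Lemma setprod_le_exp A (z : nat) :
  (forall q, q \in A -> (q <= z)%N) -> (setprod A <= z ^ #|A|)%N.
Proof.
move=> h; rewrite /setprod -prod_nat_const.
by apply: leq_prod => q /h.
Qed.

Lemma exp_le_setprod A (z : nat) :
  (forall q, q \in A -> (z <= q)%N) -> (z ^ #|A| <= setprod A)%N.
Proof.
move=> h; rewrite /setprod -prod_nat_const.
by apply: leq_prod => q /h.
Qed.

End PrimeSets.

(** * The sieve *)

Section Sieve.
Import fintype finset.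
Local Open Scope set_scope.
Variables (R : realType) (N : nat) (v g : nat -> R) (D : nat) (tau : R).
Local Notation T := 'I_N.+1.
Implicit Types (A B X U : {set T}).
Hypothesis v_ge0 : forall n, 0 <= v n.
Hypothesis v_sum : \sum_(1 <= n < N.+1) v n <= 1.
Hypothesis g_ge0 : forall d, 0 <= g d.
Hypothesis g1 : g 1 = 1.
Hypothesis gM : forall a b, coprime a b -> g (a * b)%N = g a * g b.
(** The densities 1 / q and 1 / (q - 1) both satisfy the next two bounds, the former with equality
    in the first, the latter with equality in the second. *)
Hypothesis g_lo : forall q, prime q -> q%:R^-1 <= g q.
Hypothesis g_hi : forall q, prime q -> (1 - q%:R^-1) * g q <= q%:R^-1.

Definition mean (f : nat -> R) : R := \sum_(1 <= n < N.+1) v n * f n.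

Hypothesis tauP :
  \sum_(1 <= d < D.+1) `|mean (fun n => (d %| n)%N%:R) - g d| <= tau.

Local Notation E := mean.
Local Notation PR := (primeset N).
Local Notation F := (prime_divs N).
Local Notation gs A := (\prod_(q in A) g q).

Lemma mean_le (f h : nat -> R) : (forall n, (0 < n <= N)%N -> f n <= h n) -> E f <= E h.
Proof.
move=> fh; rewrite /mean big_nat_cond [leRHS]big_nat_cond; apply: ler_sum => n /andP[hn _].
by rewrite ler_wpM2l// fh.
Qed.

Lemma mean_sum (I : finType) (P : pred I) (f : I -> nat -> R) :
  E (fun n => \sum_(i | P i) f i n) = \sum_(i | P i) E (f i).
Proof.
by rewrite /mean exchange_big/=; apply: eq_bigr => n _; rewrite mulr_sumr.
Qed.

Lemma meanD (f h : nat -> R) : E (fun n => f n + h n) = E f + E h.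
Proof. by rewrite /mean -big_split/=; apply: eq_bigr => n _; rewrite mulrDr. Qed.

Lemma meanZ (c : R) (f : nat -> R) : E (fun n => c * f n) = c * E f.
Proof. by rewrite /mean mulr_sumr; apply: eq_bigr => n _; rewrite mulrCA. Qed.

Lemma mean_norm_le (f h : nat -> R) :
  (forall n, (0 < n <= N)%N -> `|f n| <= h n) -> `|E f| <= E h.
Proof.
move=> fh; apply: le_trans (ler_norm_sum _ _ _) _.
rewrite big_nat_cond [leRHS]big_nat_cond; apply: ler_sum => n /andP[hn _].
by rewrite normrM ger0_norm// ler_wpM2l// fh.
Qed.

Lemma tau_ge0 : 0 <= tau.
Proof. by apply: le_trans tauP; rewrite sumr_ge0. Qed.

Lemma g_setprod A : A \subset PR -> g (setprod N A) = gs A.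
Proof.
move=> AP; rewrite setprodE -big_enum/=.
have := uniq_vals N A; have := prime_vals N A AP.
elim: (enum A) => [|a s IH] /=; first by rewrite !big_nil g1.
move=> /andP[pa ps] /andP[ns us]; rewrite !big_cons gM ?IH//.
rewrite prime_coprime//; apply: contra ns; exact: prime_dvd_prod_primes.
Qed.

Lemma primeset_prime A q : A \subset PR -> q \in A -> prime q.
Proof. by move=> AP /(subsetP AP); rewrite inE. Qed.

Lemma g_le2 q : prime q -> g q <= 2 * q%:R^-1.
Proof.
move=> pq; have q2 : (2 : R) <= q%:R by rewrite ler_nat prime_gt1.
have h : q%:R^-1 <= 1 / 2 :> R by rewrite -div1r ler_pdivrMr; lra.
by have := g_hi q pq; have := g_ge0 q; nra.
Qed.

Lemma g_le1 q : prime q -> g q <= 1.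
Proof.
move=> pq; have q2 : (2 : R) <= q%:R by rewrite ler_nat prime_gt1.
have h : q%:R^-1 <= 1 / 2 :> R by rewrite -div1r ler_pdivrMr; lra.
by have := g_le2 q pq; lra.
Qed.

Definition level_err A : R := `|E (fun n => (A \subset F n)%:R) - gs A|.

(** The same modulus may come from several indices, for instance as the union of different pairs; m
    bounds this multiplicity. *)
Lemma level_err_sum (J : finType) (P : pred J) (S : J -> {set T}) (m : nat) :
  (forall j, P j -> S j \subset PR) -> (forall j, P j -> (setprod N (S j) <= D)%N) ->
  (forall U, (#|[set j | P j & S j == U]| <= m)%N) ->
  \sum_(j | P j) level_err (S j) <= m%:R * tau.
Proof.
move=> SP SD Sm.
pose ok U := (U \subset PR) && (setprod N U <= D)%N.
rewrite (partition_big S ok)/=; last by move=> j Pj; rewrite /ok SP// SD.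
apply: (@le_trans _ _ (\sum_(U | ok U) m%:R * level_err U)).
  apply: ler_sum => U _.
  rewrite (eq_bigr (fun=> level_err U)); last by move=> j /andP[_ /eqP->].
  rewrite (eq_bigl (fun j => j \in [set j | P j & S j == U])); last by move=> j; rewrite inE.
  by rewrite sumr_const -(mulr_natl (level_err U)) ler_wpM2r// ?normr_ge0// ler_nat.
rewrite -mulr_sumr ler_wpM2l//; apply: le_trans tauP.
rewrite big_add1/= big_mkord.
pose err d := `|E (fun n => (d %| n)%N%:R) - g d|.
pose h U : 'I_D.+1 := inord (setprod N U).
have okP U : ok U -> h U = setprod N U :> nat by case/andP => _ UD; rewrite /h inordK.
have -> : \sum_(U | ok U) level_err U = \sum_(U in [set U | ok U]) err (h U).
  apply: eq_big => U; first by rewrite inE.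
  move=> okU; rewrite /err (okP U okU); case/andP: okU => UP _.
  rewrite g_setprod// /level_err; congr `|_ - _|; apply: eq_bigr => n _.
  by rewrite setprod_dvd.
rewrite -(big_imset (fun d : 'I_D.+1 => err d))/=; last first.
  move=> U U'; rewrite !inE => oU oU' /(congr1 val)/=; rewrite !okP// => e.
  case/andP: oU => UP _; case/andP: oU' => UP' _.
  by rewrite -(prime_divs_setprod N U UP) e prime_divs_setprod.
rewrite big_mkcond big_ord_recl/= ifF ?add0r; last first.
  apply/negP => /imsetP[U]; rewrite inE => oU /(congr1 val)/=; rewrite okP// => e.
  by case/andP: oU => /setprod_gt0; rewrite -e.
apply: ler_sum => i _; case: ifP => _; rewrite ?normr_ge0//.
Qed.

Lemma mean_count_le (J : finType) (P : pred J) (S : J -> {set T}) (m : nat) :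
  (forall j, P j -> S j \subset PR) -> (forall j, P j -> (setprod N (S j) <= D)%N) ->
  (forall U, (#|[set j | P j & S j == U]| <= m)%N) ->
  E (fun n => \sum_(j | P j) (S j \subset F n)%:R) <= \sum_(j | P j) gs (S j) + m%:R * tau.
Proof.
move=> SP SD Sm; rewrite mean_sum.
apply: le_trans (lerD (lexx _) (level_err_sum J P S m SP SD Sm)).
rewrite -big_split/=; apply: ler_sum => j _; rewrite /level_err.
by have := ler_norm (E (fun n => (S j \subset F n)%:R) - gs (S j)); lra.
Qed.

Lemma card_fiber_inj (J : finType) (P : pred J) (S : J -> {set T}) U :
  {in P &, injective S} -> (#|[set j | P j & S j == U]| <= 1)%N.
Proof.
move=> Si; apply/card_le1_eqP => i j; rewrite !inE => /andP[Pi /eqP Ui] /andP[Pj /eqP Uj].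
by apply: Si => //; rewrite Ui Uj.
Qed.

(** * Variance of the number of prime factors in a window *)

Section TuranKubilius.
Variable W : {set T}.
Hypothesis WP : W \subset PR.
Hypothesis WD : forall q r, q \in W -> r \in W -> (q * r <= D)%N.
Let V := \sum_(q in W) g q.
Let om n : R := \sum_(q in W) (q \in F n)%:R.

(** Expand the square, bounding the second moment from above and the first from below. In 4 tau, the
    4 bounds the number of pairs (q, r) with a given set of entries; the diagonal pairs give the
    main term V. *)
Lemma turan_kubilius : E (fun n => (om n - V) ^+ 2) <= V + 4 * tau + 2 * V * tau.
Proof.
have V0 : 0 <= V by rewrite sumr_ge0.
have -> : E (fun n => (om n - V) ^+ 2) = E (fun n => om n ^+ 2) + (- (2 * V)) * E om + V ^+ 2 * E
  (fun=> 1).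
  rewrite -!meanZ -!meanD; apply: eq_bigr => n _; congr (_ * _); ring.
have h2 : E (fun n => om n ^+ 2) <= V ^+ 2 + V + 4 * tau.
  have := @mean_count_le (T * T)%type (fun p => (p.1 \in W) && (p.2 \in W)) (fun p => [set p.1; p.2]) 4.
  have -> : E (fun n => \sum_(j : T * T | (j.1 \in W) && (j.2 \in W)) ([set j.1; j.2] \subset F
    n)%:R) = E (fun n => om n ^+ 2).
    apply: eq_bigr => n _; congr (_ * _); rewrite expr2 /om big_distrlr/= pair_big/=.
    by apply: eq_bigr => -[q r] _ /=; rewrite finset.subUset !finset.sub1set -natrM mulnb.
  move=> h; apply: le_trans (h _ _ _) _.
  - by move=> [q r] /= /andP[qW rW]; rewrite finset.subUset !finset.sub1set !(subsetP WP).
  - move=> [q r] /= /andP[qW rW]; have [->|qr] := eqVneq q r.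
      rewrite finset.setUid /setprod big_set1; apply: leq_trans (WD r r rW rW).
      by rewrite leq_pmulr// prime_gt0// (primeset_prime _ _ WP).
    rewrite setprodU; last by apply/finset.setP => x; rewrite !inE; apply/andP => -[/eqP-> /eqP e];
      rewrite e eqxx in qr.
    by rewrite /setprod !big_set1 WD.
  - move=> U; pose Y := [set j : T * T | (j.1 \in W) && (j.2 \in W) & [set j.1; j.2] == U].
    have [/eqP Y0|[[q r] qrY]] := set_0Vmem Y.
      by rewrite -/Y; move/eqP: Y0 => ->; rewrite cards0.
    have U2 : (#|U| <= 2)%N.
      by move: qrY; rewrite inE => /andP[_ /eqP<-]; rewrite cards2; case: (_ != _).
    apply: (@leq_trans #|finset.setX U U|); last by rewrite cardsX (leq_mul U2 U2).
    apply: subset_leq_card; apply/subsetP => -[q' r']; rewrite !inE/= => /andP[_ /eqP<-].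
    by rewrite !inE !eqxx orbT.
  rewrite lerD2r.
  have -> : V ^+ 2 + V = \sum_(j : T * T | (j.1 \in W) && (j.2 \in W)) (g j.1 * g j.2 + (if j.1 ==
    j.2 then g j.1 else 0)).
    rewrite big_split/=; congr (_ + _).
      by rewrite expr2 /V big_distrlr/= pair_big.
    rewrite -(pair_big (fun q => q \in W) (fun r => r \in W) (fun q r => if q == r then g q else 0))/=.
    apply: eq_bigr => q qW; rewrite (bigD1 q)//= eqxx big1 ?addr0// => r /andP[_ rq].
    by rewrite eq_sym (negbTE rq).
  apply: ler_sum => -[q r] _ /=; case: eqVneq => [->|qr].
    by rewrite finset.setUid big_set1 lerDr mulr_ge0.
  by rewrite big_setU1 ?inE//= big_set1 addr0.
have h1 : V - tau <= E om.
  have := @level_err_sum T (fun q => q \in W) (fun q => [set q]) 1.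
  rewrite mul1r => h.
  have {}h : \sum_(q in W) level_err [set q] <= tau.
    apply: h.
    - by move=> q qW; rewrite finset.sub1set (subsetP WP).
    - move=> q qW; rewrite /setprod big_set1; apply: leq_trans (WD q q qW qW).
      by rewrite leq_pmulr// prime_gt0// (primeset_prime _ _ WP).
    - move=> U; apply: card_fiber_inj => q r _ _; exact: finset.set1_inj.
  rewrite lerBlDr; apply: le_trans (lerD (lexx _) h).
  rewrite /om mean_sum -big_split/=; apply: ler_sum => q _.
  rewrite /level_err big_set1.
  have -> : E (fun n => ([set q] \subset F n)%:R) = E (fun n => (q \in F n)%:R).
    by apply: eq_bigr => n _; rewrite finset.sub1set.
  by have := ler_norm (- (E (fun n => (q \in F n)%:R) - g q)); rewrite normrN; lra.
have h0 : E (fun=> 1) <= 1 by rewrite /mean; under eq_bigr do rewrite mulr1.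
have t0 := tau_ge0.
by nra.
Qed.

(** Chebyshev's inequality: at most k <= V / 2 primes force a deviation of at least V / 2, and the
    variance is at most 7 V, whence 28 = 4 * 7. *)
Lemma few_window_primes (k : nat) : tau <= 1 -> 1 <= V -> k%:R <= V / 2 ->
  E (fun n => (#|W :&: F n| <= k)%N%:R) <= 28 / V.
Proof.
move=> t1 V1 kV; have t0 := tau_ge0.
rewrite ler_pdivlMr; last lra.
have V0 : 0 < V by lra.
rewrite -(ler_pM2r V0).
apply: (@le_trans _ _ (4 * E (fun n => (om n - V) ^+ 2))); last by have := turan_kubilius; nra.
rewrite -mulrA mulrC -!meanZ; apply: mean_le => n _.
have -> : om n = #|W :&: F n|%:R.
  rewrite /om -sum1_card natr_sum big_mkcond [RHS]big_mkcond; apply: eq_bigr => q _.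
  by rewrite !inE; case: (q \in W) => //=; case: (_ && _).
case: leqP => [h|_]; last by rewrite mulr0 mulr_ge0// sqr_ge0.
rewrite mulr1; move: h; rewrite -(ler_nat R) => h; nra.
Qed.

End TuranKubilius.

(** * Truncated inclusion-exclusion and its exceptional integers *)

Section Truncation.
Variables (X W : {set T}) (k z L Dp : nat) (C lam : R).
Hypothesis XP : X \subset PR.
Hypothesis XC : \sum_(q in X) (q%:R^-1 : R) <= C.
Hypothesis z0 : (0 < z)%N.
Hypothesis zD : (z ^ (2 * k) <= D)%N.
Hypothesis zN : (N < z.+1 ^ L.+1)%N.
Hypothesis DpD : (Dp <= D)%N.
Hypothesis WP : W \subset PR.
Hypothesis WD : forall q r, q \in W -> r \in W -> (q * r <= D)%N.
Hypothesis WN : forall q, q \in W -> (N < q * Dp.+1)%N.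
Hypothesis W1 : 1 <= \sum_(q in W) g q.
Hypothesis Wk : k%:R <= (\sum_(q in W) g q) / 2.
Hypothesis tau1 : tau <= 1.
Hypothesis lam0 : 0 < lam.
Let V := \sum_(q in W) g q.

Definition trunc_fam A := [&& A \subset X, (#|A| <= k)%N & (setprod N A <= Dp)%N].

Definition trunc_sum n : R :=
  \sum_(A : {set T} | trunc_fam A) (-1) ^+ #|A| * (A \subset F n)%:R.

Let Y n : R := \sum_(A : {set T} | (A \subset X) && (#|A| <= k)%N) (A \subset F n)%:R.
Let Yk n : R := \sum_(A : {set T} | trunc_fam A && (#|A| == k)) (A \subset F n)%:R.
Let bad n := [exists A : {set T}, [&& A \subset X, A \subset F n, (#|A| <= k)%N & (Dp < setprod N
  A)%N]].

Lemma sum_g_le : \sum_(q in X) g q <= 2 * C.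
Proof.
apply: (@le_trans _ _ (2 * \sum_(q in X) q%:R^-1)); last by rewrite ler_wpM2l.
rewrite mulr_sumr; apply: ler_sum => q qX; apply: g_le2; exact: primeset_prime XP qX.
Qed.

Lemma sum_pow_gs_le (t : R) : 0 <= t ->
  \sum_(A : {set T} | A \subset X) t ^+ #|A| * gs A <= expR (2 * t * C).
Proof.
move=> t0; apply: le_trans (sum_subset_pow_le _ _ X (fun q : T => g q) t t0 _) _ => //.
by rewrite ler_expR; have := ler_wpM2l t0 sum_g_le; lra.
Qed.

Lemma gs_ge0 A : 0 <= gs A. Proof. by rewrite prodr_ge0. Qed.

(** Rankin's trick: sets of size k are weighted by 2^(|A| - k) and the sum is extended to all
    subsets of X. *)
Lemma mean_exact_count_le : E Yk <= 2 ^- k * expR (4 * C) + tau.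
Proof.
apply: le_trans (mean_count_le _ _ id 1 _ _ _) _.
- by move=> A /andP[/and3P[AX _ _] _]; apply: subset_trans XP.
- by move=> A /andP[/and3P[_ _ h] _]; apply: leq_trans DpD.
- by move=> U; apply: card_fiber_inj => A B _ _.
rewrite mul1r lerD2r.
apply: (@le_trans _ _ (\sum_(A : {set T} | A \subset X) 2 ^- k * (2 ^+ #|A| * gs A))).
  rewrite big_mkcond [leRHS]big_mkcond; apply: ler_sum => A _.
  case: ifPn => [/andP[/and3P[-> _ _] /eqP->]|_].
    by rewrite mulrA mulVf ?mul1r// expf_neq0.
  by case: ifP; rewrite // !mulr_ge0 ?gs_ge0 ?invr_ge0 ?exprn_ge0.
rewrite -mulr_sumr ler_wpM2l ?invr_ge0 ?exprn_ge0//.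
by apply: le_trans (sum_pow_gs_le 2 _) _ => //; rewrite ler_expR; lra.
Qed.

(* An integer [n <= N] has at most [L] prime factors above [z], so [Y] can be bounded by its
   analogue [Ys] over the primes up to [z], whose second moment involves only moduli up to [D]. *)
Let Xs := [set q in X | (q <= z)%N].
Let Ys n : R := \sum_(A : {set T} | (A \subset Xs) && (#|A| <= k)%N) (A \subset F n)%:R.

Lemma small_part_sub : Xs \subset X. Proof. by apply/subsetP => q; rewrite inE => /andP[]. Qed.

Lemma card_cover_pairs U (P : pred ({set T} * {set T})) :
  (#|[set p : {set T} * {set T} | P p & p.1 :|: p.2 == U]| <= 4 ^ #|U|)%N.
Proof.
apply: (@leq_trans #|finset.setX (powerset U) (powerset U)|); last first.
  by rewrite cardsX !card_powerset -expnMn.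
apply: subset_leq_card; apply/subsetP => -[A B]; rewrite !inE/= => /andP[_ /eqP<-].
by rewrite finset.subsetUl finset.subsetUr.
Qed.

(** The square is a sum over pairs, whose unions have at most 2 k primes up to z and so stay within
    the level. A union U comes from at most 4^|U| pairs, which gives 16^k in the error and the
    weight 4^|U| in the main term. *)
Lemma mean_small_count_sqr_le : E (fun n => Ys n ^+ 2) <= expR (8 * C) + 16 ^+ k * tau.
Proof.
pose P (p : {set T} * {set T}) := ((p.1 \subset Xs) && (#|p.1| <= k)%N) && ((p.2 \subset Xs) &&
  (#|p.2| <= k)%N).
have PU p : P p -> (p.1 :|: p.2 \subset Xs) /\ (#|p.1 :|: p.2| <= 2 * k)%N.
  case/andP => /andP[p1 c1] /andP[p2 c2]; rewrite finset.subUset p1 p2; split=> //.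
  by apply: leq_trans (leq_card_setU _ _) _; rewrite mul2n -addnn leq_add.
have -> : E (fun n => Ys n ^+ 2) = E (fun n => \sum_(p | P p) (p.1 :|: p.2 \subset F n)%:R).
  apply: eq_bigr => n _; congr (_ * _); rewrite expr2 /Ys big_distrlr/= pair_big/=.
  by apply: eq_bigr => -[A B] _ /=; rewrite finset.subUset -natrM mulnb.
apply: le_trans (mean_count_le _ P (fun p => p.1 :|: p.2) (16 ^ k)%N _ _ _) _.
- by move=> p /PU[h _]; apply: subset_trans h (subset_trans small_part_sub XP).
- move=> p /PU[h c]; apply: leq_trans zD; apply: leq_trans (setprod_le_exp N _ z _) _.
    by move=> q /(subsetP h); rewrite inE => /andP[].
  exact: leq_pexp2l.
- move=> U; case: (set_0Vmem [set p | P p & p.1 :|: p.2 == U]) => [->|[p]]; first by rewrite cards0.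
  rewrite inE => /andP[/PU[_ c] /eqP pU]; rewrite pU in c.
  apply: leq_trans (card_cover_pairs _ _) _.
  by rewrite -[16%N]/(4 ^ 2)%N -expnM leq_pexp2l.
rewrite natrX lerD2r.
rewrite (partition_big (fun p => p.1 :|: p.2) (fun U => U \subset X))/=; last first.
  by move=> p /PU[h _]; apply: subset_trans small_part_sub.
apply: (@le_trans _ _ (\sum_(U : {set T} | U \subset X) 4 ^+ #|U| * gs U)); last first.
  by apply: le_trans (sum_pow_gs_le 4 _) _ => //; rewrite ler_expR; lra.
apply: ler_sum => U _.
rewrite [leLHS](eq_bigr (fun=> gs U)); last by move=> p /andP[_ /eqP->].
rewrite (eq_bigl (fun p => p \in [set p | P p & p.1 :|: p.2 == U])); last by move=> p; rewrite inE.
rewrite sumr_const -(mulr_natl (gs U)) ler_wpM2r ?gs_ge0//.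
by rewrite -natrX ler_nat card_cover_pairs.
Qed.

Lemma count_le_small_count n : (0 < n <= N)%N -> Y n <= 2 ^+ L * Ys n.
Proof.
move=> /andP[n0 nN].
have cardY (Z : {set T}) : \sum_(A : {set T} | (A \subset Z) && (#|A| <= k)%N) (A \subset F n)%:R =
   #|[set A : {set T} | (A \subset Z :&: F n) && (#|A| <= k)%N]|%:R :> R.
  rewrite -sum1_card natr_sum big_mkcond [RHS]big_mkcond; apply: eq_bigr => A _.
  by rewrite inE finset.subsetI; case: (A \subset Z); case: (A \subset F n); case: leqP.
rewrite /Y /Ys !cardY -natrX -natrM ler_nat mulnC.
pose Xl := [set q in X | (z < q)%N].
have XlL : (#|Xl :&: F n| <= L)%N.
  have sub : Xl :&: F n \subset PR.
    by apply/subsetP => q; rewrite !inE => /andP[_ /andP[]].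
  have h q : q \in Xl :&: F n -> (z < q)%N by rewrite !inE => /andP[/andP[]].
  have h2 : (z.+1 ^ #|Xl :&: F n| <= n)%N.
    apply: leq_trans (@exp_le_setprod N (Xl :&: F n) z.+1 h) _.
    by rewrite dvdn_leq// setprod_dvd// finset.subsetIr.
  rewrite leqNgt; apply/negP => h3.
  have := leq_trans (leq_pexp2l (ltn0Sn z) h3) h2.
  by rewrite leqNgt (leq_ltn_trans nN zN).
apply: (@leq_trans #|finset.setX [set A : {set T} | (A \subset Xs :&: F n) && (#|A| <= k)%N]
  (powerset (Xl :&: F n))|).
  apply: (@leq_trans #|(fun p : {set T} * {set T} => p.1 :|: p.2) @: finset.setX [set A : {set T} |
    (A \subset Xs :&: F n) && (#|A| <= k)%N] (powerset (Xl :&: F n))|); last exact: leq_imset_card.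
  apply: subset_leq_card; apply/subsetP => A; rewrite inE => /andP[AX Ak].
  apply/imsetP; exists (A :&: Xs, A :&: Xl); last first.
    rewrite /= -finset.setIUr; symmetry; apply/finset.setIidPl; apply/subsetP => q /(subsetP AX).
    by rewrite !inE => /andP[-> _]/=; case: leqP.
  rewrite !inE/= (leq_trans (subset_leq_card (finset.subsetIl _ _)) Ak) andbT.
  move: AX; rewrite finset.subsetI => /andP[_ AF].
  by rewrite !finset.subsetI !finset.subsetIr !(subset_trans (finset.subsetIl _ _) AF).
by rewrite cardsX card_powerset leq_mul2l leq_pexp2l ?orbT.
Qed.

(** If a prime q of W divides n but is not in A, then q times the product of A divides n, yet it is
    at least q (Dp + 1) > N. So all prime factors of n in W belong to A. *)
Lemma bad_few_window_primes n : (0 < n <= N)%N -> bad n -> (#|W :&: F n| <= k)%N.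
Proof.
move=> /andP[n0 nN] /existsP[A /and4P[AX AF Ak AD]].
apply: leq_trans Ak; apply: subset_leq_card; apply/subsetP => q; rewrite inE => /andP[qW qF].
apply/negPn/negP => qA.
have h : q |: A \subset F n by rewrite finset.subUset finset.sub1set qF.
have hP : q |: A \subset PR.
  by rewrite finset.subUset finset.sub1set (subsetP WP)//= (subset_trans AX).
have := dvdn_leq n0; move=> /(_ (setprod N (q |: A))); rewrite setprod_dvd// => /(_ h).
rewrite /setprod big_setU1//= => h2.
have := WN q qW; rewrite ltnNge => /negP; apply.
by apply: leq_trans nN; apply: leq_trans h2; rewrite leq_mul2l AD orbT.
Qed.

(** If n is not bad, the cut-off at Dp removes no divisor of n and Bonferroni applies; if n is bad,
    the difference is trivially at most 1 + Y <= 2 Y. *)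
Lemma trunc_pointwise n :
  `|(X :&: F n == finset.set0)%:R - trunc_sum n| <= Yk n + (bad n)%:R * (2 * Y n).
Proof.
have Y1 : 1 <= Y n.
  rewrite /Y (bigD1 finset.set0)/=; last by rewrite finset.sub0set cards0.
  by rewrite finset.sub0set lerDl sumr_ge0.
have Yk0 : 0 <= Yk n by rewrite sumr_ge0.
have [nb|nb] := boolP (bad n).
  rewrite mul1r ler_wpDl//.
  have : `|trunc_sum n| <= Y n.
    apply: le_trans (ler_norm_sum _ _ _) _; rewrite big_mkcond [leRHS]big_mkcond.
    apply: ler_sum => A _; case: ifPn => [/and3P[-> -> _]|_]; last by case: ifP.
    by rewrite normrM normrX normrN1 expr1n mul1r normr_nat.
  have : `|(X :&: F n == finset.set0)%:R : R| <= 1 by rewrite normr_nat; case: (_ == _).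
  have := ler_normB ((X :&: F n == finset.set0)%:R : R) (trunc_sum n).
  lra.
rewrite mul0r addr0.
have small A : A \subset X :&: F n -> (#|A| <= k)%N -> (setprod N A <= Dp)%N.
  rewrite finset.subsetI => /andP[AX AF] Ak; rewrite leqNgt; apply/negP => h.
  by case/negP: nb; apply/existsP; exists A; apply/and4P.
have -> : trunc_sum n = \sum_(A : {set T} | (A \subset X :&: F n) && (#|A| <= k)%N) (-1) ^+ #|A|.
  rewrite /trunc_sum big_mkcond [RHS]big_mkcond; apply: eq_bigr => A _.
  have [AXF|] := boolP (A \subset X :&: F n).
    have := small A AXF; move: AXF; rewrite finset.subsetI /trunc_fam => /andP[-> ->] h /=.
    by case: leqP => [/h->|]//=; rewrite mulr1.
  rewrite finset.subsetI negb_and /trunc_fam /= => /orP[/negbTE->//|/negbTE->].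
  by rewrite mulr0 if_same.
have -> : Yk n = \sum_(A : {set T} | (A \subset X :&: F n) && (#|A| == k)) 1.
  rewrite /Yk big_mkcond [RHS]big_mkcond; apply: eq_bigr => A _.
  have [AXF|] := boolP (A \subset X :&: F n).
    have := small A AXF; move: AXF; rewrite finset.subsetI /trunc_fam => /andP[-> ->] h /=.
    by case: eqP => [e|_]; rewrite ?andbF// h e leqnn.
  rewrite finset.subsetI negb_and /trunc_fam /= => /orP[/negbTE->//|/negbTE->].
  by rewrite if_same.
exact: bonferroni.
Qed.

(** The weight h will be the indicator of having no prime factor in X1, the small primes that are
    sieved exactly. *)
Lemma trunc_mean (h : nat -> R) : (forall n, 0 <= h n <= 1) ->
  `|E (fun n => h n * (X :&: F n == finset.set0)%:R) - E (fun n => h n * trunc_sum n)| <=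
  2 ^- k * expR (4 * C) + tau + lam * (4 ^+ L * (expR (8 * C) + 16 ^+ k * tau)) + 28 / (V * lam).
Proof.
move=> h01.
have -> : E (fun n => h n * (X :&: F n == finset.set0)%:R) - E (fun n => h n * trunc_sum n) =
  E (fun n => h n * ((X :&: F n == finset.set0)%:R - trunc_sum n)).
  rewrite -mulN1r -meanZ -meanD; apply: eq_bigr => n _; congr (_ * _); ring.
apply: (@le_trans _ _ (E (fun n => (Yk n + lam * (4 ^+ L * Ys n ^+ 2)) + lam^-1 * (#|W :&: F n| <=
  k)%N%:R))).
  apply: mean_norm_le => n hn.
  have [h0 h1] := andP (h01 n).
  rewrite normrM (ger0_norm h0).
  apply: (@le_trans _ _ (Yk n + (bad n)%:R * (2 * Y n))).
    by have := trunc_pointwise n; have := normr_ge0 ((X :&: F n == finset.set0)%:R - trunc_sum n); nra.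
  rewrite -addrA lerD2l.
  have li : 0 <= lam^-1 by rewrite invr_ge0 ltW.
  have h3 : 0 <= lam * (4 ^+ L * Ys n ^+ 2) by rewrite mulr_ge0 ?(ltW lam0)// mulr_ge0 ?sqr_ge0//
    exprn_ge0.
  have [nb|nb] := boolP (bad n); last by rewrite mul0r addr_ge0// mulr_ge0.
  rewrite (bad_few_window_primes n hn nb) mulr1 mul1r.
  apply: (@le_trans _ _ (2 * (2 ^+ L * Ys n))); first by rewrite ler_wpM2l// count_le_small_count.
  have -> : 4 ^+ L * Ys n ^+ 2 = (2 ^+ L * Ys n) ^+ 2.
    by rewrite exprMn exprAC -[2 ^+ 2]natrX.
  (* AM-GM: [2 y <= lam y^2 + 1 / lam] *)
  set y := 2 ^+ L * Ys n; rewrite -subr_ge0.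
  have -> : lam * y ^+ 2 + lam^-1 - 2 * y = lam^-1 * (lam * y - 1) ^+ 2.
    by field; rewrite gt_eqF.
  by rewrite mulr_ge0// sqr_ge0.
rewrite !meanD !meanZ; apply: lerD; first apply: lerD.
- exact: mean_exact_count_le.
- by rewrite !ler_wpM2l ?exprn_ge0 ?(ltW lam0)//; exact: mean_small_count_sqr_le.
- rewrite invfM mulrA [leRHS]mulrC ler_wpM2l ?invr_ge0 ?(ltW lam0)//.
  exact: few_window_primes.
Qed.

Variables (X1 : {set T}) (w : nat).
Hypothesis X1P : X1 \subset PR.
Hypothesis X1X : X1 :&: X = finset.set0.
Hypothesis X1D : (setprod N X1 * Dp <= D)%N.
Hypothesis w0 : (0 < w)%N.
Hypothesis wX : forall q, q \in X -> (w <= q)%N.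

Lemma sifted_expand n : (X1 :&: F n == finset.set0)%:R =
  \sum_(A : {set T} | A \subset X1) (-1) ^+ #|A| * (A \subset F n)%:R :> R.
Proof.
rewrite (eq_bigr (fun A : {set T} => \prod_(q in A) (- (q \in F n)%:R : R))); last first.
  move=> A _; rewrite prodrN; congr (_ * _).
  have [AF|/subsetPn[q qA qF]] := boolP (A \subset F n).
    by rewrite big1// => q qA; rewrite (subsetP AF).
  by rewrite (bigD1 q)//= (negbTE qF) mul0r.
rewrite sum_subset_prod; case: (set_0Vmem (X1 :&: F n)) => [e|[q]].
  rewrite e eqxx big1// => q qX.
  have : q \notin X1 :&: F n by rewrite e inE.
  by rewrite inE qX/= => /negbTE->; rewrite subr0.
move=> qXF; have /negbTE -> : X1 :&: F n != finset.set0 by apply/set0Pn; exists q.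
move: qXF; rewrite inE => /andP[qX qF].
by rewrite (bigD1 q)//= qF subrr mul0r.
Qed.

Lemma gs_setU A B : A :&: B = finset.set0 -> gs (A :|: B) = gs A * gs B.
Proof.
move=> AB; rewrite -bigU/=; first by apply: eq_bigl => q; rewrite !inE.
by rewrite -finset.setI_eq0 AB.
Qed.

(** As X1 and X are disjoint, a pair is determined by its union: every modulus occurs once, and the
    error is tau without a factor depending on X1. *)
Lemma mean_trunc_sum :
  `|E (fun n => (X1 :&: F n == finset.set0)%:R * trunc_sum n) -
    (\prod_(q in X1) (1 - g q)) * (\sum_(A : {set T} | trunc_fam A) (-1) ^+ #|A| * gs A)| <= tau.
Proof.
pose P (p : {set T} * {set T}) := (p.1 \subset X1) && trunc_fam p.2.
have Pdis p : P p -> p.1 :&: p.2 = finset.set0.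
  case/andP => p1 /and3P[p2 _ _]; apply/eqP; rewrite -finset.subset0 -X1X.
  exact: finset.setISS.
have Pinj : {in P &, injective (fun p : {set T} * {set T} => p.1 :|: p.2)}.
  have rec p : P p -> p = ((p.1 :|: p.2) :&: X1, (p.1 :|: p.2) :&: X).
    case: p => A B /andP[/= A1 /and3P[B2 _ _]]; congr (_, _); apply/finset.setP => q.
      rewrite !inE; have [qA|qA] := boolP (q \in A); first by rewrite (subsetP A1).
      symmetry; apply/negP => /andP[/= qB qX1].
      have : q \in X1 :&: X by rewrite inE qX1 (subsetP B2).
      by rewrite X1X inE.
    rewrite !inE; have [qB|qB] := boolP (q \in B); first by rewrite orbT (subsetP B2).
    symmetry; rewrite orbF; apply/negP => /andP[/= qA qX].
    have : q \in X1 :&: X by rewrite inE qX (subsetP A1).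
    by rewrite X1X inE.
  by move=> p p' Pp Pp' e; rewrite (rec p Pp) (rec p' Pp') e.
have -> : E (fun n => (X1 :&: F n == finset.set0)%:R * trunc_sum n) =
  \sum_(p | P p) (-1) ^+ #|p.1| * (-1) ^+ #|p.2| * E (fun n => (p.1 :|: p.2 \subset F n)%:R).
  under [RHS]eq_bigr do rewrite -meanZ.
  rewrite -mean_sum; apply: eq_bigr => n _; congr (_ * _).
  rewrite sifted_expand /trunc_sum big_distrlr/= pair_big/=; apply: eq_bigr => -[A B] _ /=.
  by rewrite finset.subUset -mulnb natrM mulrACA.
have -> : \prod_(q in X1) (1 - g q) = \sum_(A : {set T} | A \subset X1) (-1) ^+ #|A| * gs A.
  rewrite -sum_subset_prod; apply: eq_bigr => A _; by rewrite prodrN.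
rewrite big_distrlr/= pair_big/= -sumrB.
apply: le_trans (ler_norm_sum _ _ _) _.
have := @level_err_sum _ P (fun p => p.1 :|: p.2) 1.
rewrite mul1r => h; apply: le_trans (h _ _ _); last first.
- by move=> U; apply: card_fiber_inj.
- move=> p Pp; rewrite setprodU ?Pdis//; apply: leq_trans X1D.
  by case/andP: Pp => p1 /and3P[_ _ p2]; rewrite leq_mul// setprod_sub.
- by move=> p /andP[p1 /and3P[p2 _ _]]; rewrite finset.subUset (subset_trans p1)// (subset_trans p2).
apply: ler_sum => p Pp; rewrite mulrACA -gs_setU ?Pdis// -mulrBr normrM normrM !normrX normrN1
  !expr1n !mul1r.
by [].
Qed.

Lemma bernoulli_sub (u : R) (n : nat) : 0 <= u <= 1 -> 1 - n%:R * u <= (1 - u) ^+ n.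
Proof.
move=> /andP[u0 u1]; elim: n => [|n IH]; first by rewrite mul0r subr0 expr0.
rewrite exprS -natr1; have n0 : (0 : R) <= n%:R by [].
have := ler_wpM2l (_ : 0 <= 1 - u) IH; rewrite subr_ge0 => /(_ u1); nra.
Qed.

(** Each g q exceeds 1 / q by a factor of at most 1 / (1 - 1 / w), and Bernoulli's inequality
    handles the at most k factors. *)
Lemma gs_recip_close A : trunc_fam A -> `|gs A - (setprod N A)%:R^-1| <= k%:R / w%:R * gs A.
Proof.
case/and3P => AX Ak _; have AP := subset_trans AX XP.
have w1 : (1 : R) <= w%:R by rewrite ler1n.
have wi : 0 <= (w%:R^-1 : R) <= 1 by rewrite invr_ge0 ler0n invf_le1//; lra.
have -> : (setprod N A)%:R^-1 = \prod_(q in A) (q%:R^-1 : R).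
  by rewrite /setprod natr_prod prodfV.
have h1 : \prod_(q in A) (q%:R^-1 : R) <= gs A.
  apply: ler_prod => q qA; rewrite invr_ge0 ler0n g_lo//; exact: primeset_prime AP qA.
have h2 : (1 - w%:R^-1) ^+ #|A| * gs A <= \prod_(q in A) (q%:R^-1 : R).
  rewrite -prodr_const -big_split/=; apply: ler_prod => q qA.
  have pq := primeset_prime _ _ AP qA; have gq := g_ge0 q.
  rewrite mulr_ge0//=; last by lra.
  apply: le_trans (g_hi q pq); rewrite ler_wpM2r// lerD2l lerN2 lef_pV2 ?posrE ?ltr0n ?(prime_gt0 pq)//.
  by rewrite ler_nat wX// (subsetP AX).
have h3 : 1 - k%:R / w%:R <= (1 - w%:R^-1) ^+ #|A| :> R.
  apply: le_trans (bernoulli_sub (w%:R^-1) #|A| wi).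
  rewrite lerD2l lerN2 ler_wpM2r ?ler_nat//; lra.
rewrite ger0_norm ?subr_ge0// lerBlDl.
have := ler_wpM2r (gs_ge0 A) h3; rewrite mulrBl mul1r => h4.
by move: h2 h4; set a := _ ^+ _ * _; set b := k%:R / _ * _; lra.
Qed.

Lemma sieve_estimate :
  `|E (fun n => ((X1 :|: X) :&: F n == finset.set0)%:R) -
    (\prod_(q in X1) (1 - g q)) *
    (\sum_(A : {set T} | trunc_fam A) (-1) ^+ #|A| * (setprod N A)%:R^-1)| <=
  2 ^- k * expR (4 * C) + tau + lam * (4 ^+ L * (expR (8 * C) + 16 ^+ k * tau)) + 28 / (V * lam)
  + tau + k%:R / w%:R * expR (2 * C).
Proof.
have e : E (fun n => ((X1 :|: X) :&: F n == finset.set0)%:R) =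
  E (fun n => (X1 :&: F n == finset.set0)%:R * (X :&: F n == finset.set0)%:R).
  by apply: eq_bigr => n _; rewrite finset.setIUl finset.setU_eq0 -natrM mulnb.
have h1 : forall n, 0 <= ((X1 :&: F n == finset.set0)%:R : R) <= 1.
  by move=> n; case: (_ == _); rewrite ?lexx ?ler01.
have := trunc_mean _ h1; rewrite -e; have := mean_trunc_sum.
have : `|(\prod_(q in X1) (1 - g q)) * (\sum_(A : {set T} | trunc_fam A) (-1) ^+ #|A| * gs A) -
   (\prod_(q in X1) (1 - g q)) *
    (\sum_(A : {set T} | trunc_fam A) (-1) ^+ #|A| * (setprod N A)%:R^-1)| <= k%:R / w%:R * expR (2
      * C).
  rewrite -mulrBr -sumrB normrM.
  have p1 : `|\prod_(q in X1) (1 - g q)| <= 1.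
    rewrite normr_prod; apply: prodr_ile1 => q qX.
    have := g_le1 q (primeset_prime _ _ X1P qX); have := g_ge0 q.
    by move=> a b; rewrite normr_ge0 ger0_norm; lra.
  apply: le_trans (ler_pM _ _ p1 (lexx _)) _ => //; rewrite mul1r.
  apply: le_trans (ler_norm_sum _ _ _) _.
  apply: (@le_trans _ _ (\sum_(A : {set T} | A \subset X) k%:R / w%:R * gs A)).
    rewrite big_mkcond [leRHS]big_mkcond; apply: ler_sum => A _.
    have c0 : 0 <= k%:R / w%:R * gs A by rewrite mulr_ge0 ?gs_ge0// divr_ge0.
    case: ifPn => [fA|_]; last by case: ifP.
    have -> : A \subset X by case/and3P: fA.
    rewrite -mulrBr normrM normrX normrN1 expr1n mul1r; exact: gs_recip_close.
  rewrite -mulr_sumr ler_wpM2l ?divr_ge0//.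
  have := sum_pow_gs_le 1 ler01; under eq_bigr do rewrite expr1n mul1r.
  by move/le_trans; apply; rewrite ler_expR; lra.
move=> hcd hbc hab.
apply: le_trans (ler_distD ((\prod_(q in X1) (1 - g q)) *
  (\sum_(A : {set T} | trunc_fam A) (-1) ^+ #|A| * gs A)) _ _) _; apply: lerD hcd.
apply: le_trans (ler_distD (E (fun n => (X1 :&: F n == finset.set0)%:R * trunc_sum n)) _ _) _.
exact: lerD hab hbc.
Qed.

End Truncation.
End Sieve.

(** * Choice of the sieve parameters *)

Section SieveLevel.
Import fintype finset.
Local Open Scope set_scope.
Variable R : realType.
Local Notation ln := (@ln R).

(* [v] is a weight on [n <= N] of total mass at most 1, [g d] the expected mass of the
   multiples of [d], and [tau] bounds the total discrepancy up to the level [D]. *)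
Record level_density (N D : nat) (tau : R) (v g : nat -> R) : Prop := LevelDensity {
  ld_v_ge0 : forall n, 0 <= v n;
  ld_v_sum : \sum_(1 <= n < N.+1) v n <= 1;
  ld_g_ge0 : forall d, 0 <= g d;
  ld_g1 : g 1 = 1;
  ld_gM : forall a b, coprime a b -> g (a * b)%N = g a * g b;
  ld_g_lo : forall q, prime q -> q%:R^-1 <= g q;
  ld_g_hi : forall q, prime q -> (1 - q%:R^-1) * g q <= q%:R^-1;
  ld_tau : \sum_(1 <= d < D.+1) `|mean R N v (fun n => (d %| n)%N%:R) - g d| <= tau }.

(** Formed with 1 / d instead of g d, hence common to both sequences. *)
Definition main_sum (N : nat) (Q : {set 'I_N.+1}) (w k Dp : nat) : R :=
  \sum_(A : {set 'I_N.+1} | trunc_fam N [set q in Q | (w <= q)%N] k Dp A)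
     (-1) ^+ #|A| * (setprod N A)%:R^-1.

Lemma exists_nat_ge (y : R) : exists n : nat, y <= n%:R.
Proof. by exists (Num.truncn y).+1; rewrite ltW// truncnS_gt. Qed.

Lemma powR_ge_of_ln (x a y : R) : 0 < x -> 0 < y -> ln y <= a * ln x -> y <= x `^ a.
Proof.
move=> x0 y0 h; rewrite -ler_ln ?posrE ?powR_gt0//; by rewrite ln_powR.
Qed.

(** All parameters are chosen before v and g, so the two applications share k, w and eps, and with
    them the same [main_sum]. The choice of w is left open from w0 on, since the comparison needs it
    large for a further reason. *)
Lemma sieve_level (C delta : R) : 0 < delta ->
  exists (k w0 : nat), forall w : nat, (w0 <= w)%N ->
  exists (eps tau0 X0 : R), [/\ 0 < eps, 0 < tau0 &
  forall (x : R) (Q : {set 'I_(Num.truncn x).+1}), X0 <= x ->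
  Q \subset primeset (Num.truncn x) -> \sum_(q in Q) (q%:R^-1 : R) <= C ->
  forall (v g : nat -> R) (tau : R), tau <= tau0 ->
  level_density (Num.truncn x) (Num.truncn (x `^ (1 - eps))) tau v g ->
  `|mean R (Num.truncn x) v (fun n => (Q :&: prime_divs (Num.truncn x) n == finset.set0)%:R) -
    (\prod_(q in Q | (q < w)%N) (1 - g q)) *
      main_sum (Num.truncn x) Q w k (Num.truncn (x `^ (1 - 2 * eps)))| <= delta].
Proof.
move=> d0.
have [k1 hk1] := exists_nat_ge (8 * expR (4 * C) / delta).
pose k := k1.+1; exists k.
have k0 : (0 < k)%N by [].
have hk : 2 ^- k * expR (4 * C) <= delta / 8.
  have : (k1%:R : R) <= 2 ^+ k.
    rewrite -natrX ler_nat; apply: (leq_trans (leqnSn _)); exact/ltnW/ltn_expl.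
  move/(le_trans hk1); rewrite ler_pdivrMr// => h.
  rewrite mulrC ler_pdivrMr ?exprn_gt0//.
  by move: h; set a := expR _; set b := 2 ^+ k; lra.
have [w1 hw1] := exists_nat_ge (8 * (k%:R * expR (2 * C)) / delta).
exists w1.+1 => w hw.
have w0 : (0 < w)%N by lia.
have w0' : (0 : R) < w%:R by rewrite ltr0n.
have hwk : k%:R / w%:R * expR (2 * C) <= delta / 8.
  have h : 8 * (k%:R * expR (2 * C)) / delta <= w%:R.
    by apply: le_trans hw1 _; rewrite ler_nat; lia.
  rewrite ler_pdivrMr// in h.
  by rewrite mulrAC ler_pdivrMr//; lra.
pose L := (4 * k)%N.
pose B := 4 ^+ L * (expR (8 * C) + 1) : R.
have B0 : 0 < B by rewrite mulr_gt0 ?exprn_gt0// addr_gt0 ?expR_gt0.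
pose lam := delta / (8 * B).
have lam0 : 0 < lam by rewrite divr_gt0// mulr_gt0.
(* The reciprocal sum V of the window is at least m / 2; V >= 224 / (delta lam) makes 28 / (V lam)
   <= delta / 8. *)
have [m hm] := exists_nat_ge (2 * (224 / (delta * lam) + 2 * k%:R + 1)).
(* Then the 4^m-th power of x^(2 eps) is x^(1/4), and two primes of the window have a product within
   the level. *)
pose eps : R := (8 * (4 ^ m)%:R)^-1.
have m4 : (0 : R) < (4 ^ m)%:R by rewrite ltr0n expn_gt0.
have m41 : (1 : R) <= (4 ^ m)%:R by rewrite ler1n expn_gt0.
have eps0 : 0 < eps by rewrite invr_gt0 mulr_gt0.
have eps8 : eps <= 1 / 8.
  by rewrite -[leLHS]div1r ler_pdivrMr ?mulr_gt0//; lra.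
(* Q has at most w C primes below w, as each has 1 / q >= 1 / w; so W0 bounds their product. *)
pose m0 := Num.truncn (w%:R * C).
pose W0 := (w ^ m0)%N.
have W01 : (1 : R) <= W0%:R by rewrite ler1n expn_gt0 w0.
pose tau0 : R := Num.min 1 (Num.min (16 ^- k) (delta / 8)).
(* For such x, x^eps >= W0 leaves room for the small primes between x^(1 - 2 eps) and the level, and
   ln (x^(2 eps)) >= 10 as [recip_windows] requires. *)
exists eps, tau0, (expR ((ln W0%:R + 10) / eps)).
have t16 : 0 < (16 ^- k : R) by rewrite invr_gt0 exprn_gt0.
split=> //.
  by rewrite /tau0 !lt_min ltr01 t16 divr_gt0.
move=> x Q hx QP QC v g tau htau [v_ge0 v_sum g_ge0 g1 gM g_lo g_hi tauP].
set N := Num.truncn x in Q QP QC v_sum tauP *.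
set D := Num.truncn (x `^ (1 - eps)) in tauP *.
set Dp := Num.truncn (x `^ (1 - 2 * eps)).
have x0 : 0 < x by apply: lt_le_trans hx; exact: expR_gt0.
have lnW : 0 <= ln W0%:R by rewrite ln_ge0.
have lx : (ln W0%:R + 10) / eps <= ln x.
  by rewrite -ler_expR (@lnK R x)// posrE.
have lx' : ln W0%:R + 10 <= eps * ln x by move: lx; rewrite ler_pdivrMr// mulrC.
have lx0 : 0 < ln x.
  by rewrite -(pmulr_rgt0 _ eps0); clear - lx' lnW; lra.
have x1 : 1 <= x by rewrite leNgt; apply/negP => xlt; have := ln_lt0 (x := x); rewrite x0 xlt =>
  /(_ isT); clear - lx0; lra.
have powE (a : R) : 0 < x `^ a by exact: powR_gt0.
have NN : (N%:R : R) <= x by rewrite truncn_le ltW.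
have xN : x < N.+1%:R by exact: truncnS_gt.
have le_D (n : nat) : (n%:R <= x `^ (1 - eps)) -> (n <= D)%N by move=> h; rewrite truncn_ge_nat// ltW.
have pow_le (a b : R) : a <= b -> x `^ a <= x `^ b by move=> ab; exact: ler_powR.
have powM (a b : R) : x `^ a * x `^ b = x `^ (a + b).
  by rewrite powRD//; apply/implyP => _; rewrite gt_eqF.
have DpX : (Dp%:R : R) <= x `^ (1 - 2 * eps) by rewrite truncn_le ltW.
have DpX' : x `^ (1 - 2 * eps) < Dp.+1%:R by exact: truncnS_gt.
have tau1 : tau <= 1 by apply: le_trans htau _; rewrite /tau0 !ge_min lexx.
have tau16 : tau <= 16 ^- k by apply: le_trans htau _; rewrite /tau0 !ge_min lexx orbT.
have taud : tau <= delta / 8 by apply: le_trans htau _; rewrite /tau0 !ge_min lexx !orbT.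
pose X := [set q in Q | (w <= q)%N].
pose X1 := [set q in Q | (q < w)%N].
have XQ : X \subset Q by apply/subsetP => q; rewrite inE => /andP[].
have X1Q : X1 \subset Q by apply/subsetP => q; rewrite inE => /andP[].
have XP := subset_trans XQ QP; have X1P := subset_trans X1Q QP.
have XC : \sum_(q in X) (q%:R^-1 : R) <= C.
  apply: le_trans QC; rewrite big_mkcond [leRHS]big_mkcond; apply: ler_sum => q _.
  case: ifPn => [/(subsetP XQ)->//|_]; by case: ifP; rewrite // invr_ge0.
have X1X : X1 :&: X = finset.set0.
  by apply/finset.setP => q; rewrite !inE; case: (q \in Q) => //=; case: leqP.
have X1U : X1 :|: X = Q.
  by apply/finset.setP => q; rewrite !inE; case: (q \in Q) => //=; case: leqP.
have X1W : (setprod N X1 <= W0)%N.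
  apply: leq_trans (setprod_le_exp N X1 w _) _.
    by move=> q; rewrite inE => /andP[_ /ltnW].
  rewrite leq_pexp2l//.
  have h : #|X1|%:R <= w%:R * C :> R.
    apply: le_trans (ler_wpM2l (ltW w0') QC).
    rewrite -sum1_card natr_sum mulr_sumr big_mkcond [leRHS]big_mkcond; apply: ler_sum => q _.
    case: ifPn => [qX1|_]; last by case: ifP; rewrite // mulr_ge0 ?invr_ge0.
    rewrite (subsetP X1Q)// ler_pdivlMr ?mul1r.
      by move: qX1; rewrite inE ler_nat => /andP[_ /ltnW].
    by rewrite ltr0n prime_gt0// (primeset_prime N X1).
  by rewrite truncn_ge_nat//; apply: le_trans h.
have epsln : W0%:R <= x `^ eps by apply: powR_ge_of_ln => //; clear - W01 lx'; lra.
have X1D : (setprod N X1 * Dp <= D)%N.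
  apply: le_D; rewrite natrM (_ : 1 - eps = eps + (1 - 2 * eps)); last ring.
  rewrite -powM; apply: ler_pM => //.
  by apply: le_trans epsln; rewrite ler_nat.
have DpD : (Dp <= D)%N.
  by apply: le_D; apply: le_trans DpX _; apply: pow_le; clear - eps0; lra.
pose z := Num.truncn (x `^ (L%:R^-1)).
have L0 : (0 : R) < L%:R by rewrite ltr0n.
have z0 : (0 < z)%N by rewrite truncn_gt0 -{1}(powRr0 x); apply: pow_le; rewrite invr_ge0.
have zX : (z%:R : R) <= x `^ (L%:R^-1) by rewrite truncn_le ltW.
have zX' : x `^ (L%:R^-1) < z.+1%:R by exact: truncnS_gt.
have zD : (z ^ (2 * k) <= D)%N.
  apply: le_D; rewrite natrX; apply: (@le_trans _ _ ((x `^ L%:R^-1) ^+ (2 * k))).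
    by rewrite lerXn2r// ?nnegrE// ltW.
  rewrite -powR_mulrn ?(ltW (powE _))// -powRrM; apply: pow_le.
  have -> : L%:R^-1 * (2 * k)%:R = 1 / 2 :> R.
    rewrite /L !natrM; field; by rewrite pnatr_eq0.
  by clear - eps8; lra.
have zN : (N < z.+1 ^ L.+1)%N.
  apply: (@leq_trans (z.+1 ^ L)); last by rewrite leq_pexp2l.
  rewrite -(ltr_nat R) natrX; apply: le_lt_trans NN _.
  have -> : x = (x `^ L%:R^-1) ^+ L.
    by rewrite -powR_mulrn ?(ltW (powE _))// -powRrM mulVf ?powRr1 ?gt_eqF// ltW.
  by rewrite ltrXn2r// ?nnegrE// ltW.
pose t := x `^ (2 * eps).
have t4 : t ^+ (4 ^ m) = x `^ (1 / 4).
  rewrite /t -powR_mulrn ?(ltW (powE _))// -powRrM; congr (_ `^ _).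
  by rewrite /eps; field; rewrite gt_eqF.
pose W := [set q : 'I_N.+1 | prime q && (t < q%:R <= t ^+ (4 ^ m))].
have WP : W \subset primeset N by apply/subsetP => q; rewrite !inE => /andP[].
have lt : 10 <= ln t by rewrite ln_powR; clear - lx' lnW; lra.
have tN : t ^+ (4 ^ m) < N.+1%:R.
  rewrite t4; apply: le_lt_trans xN; rewrite -[leRHS]powRr1 ?(ltW x0)//; apply: pow_le; clear; lra.
have WV : m%:R / 2 <= \sum_(q in W) g q.
  apply: le_trans (recip_windows R t m N lt tN) _.
  rewrite big_mkord (eq_bigl (fun q : 'I_N.+1 => q \in W)); last by move=> q; rewrite inE.
  by apply: ler_sum => q; rewrite inE => /andP[pq _]; apply: g_lo.
set V := \sum_(q in W) g q in WV.
have hV : 224 / (delta * lam) + 2 * k%:R + 1 <= V by clear - hm WV; lra.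
have dl : 0 < 224 / (delta * lam) by rewrite divr_gt0// mulr_gt0.
have kk : (0 : R) <= k%:R by [].
have V1 : 1 <= V by clear - hV dl kk; lra.
have Vk : k%:R <= V / 2 by clear - hV dl; lra.
have WD q r : q \in W -> r \in W -> (q * r <= D)%N.
  rewrite !inE t4 => /andP[_ /andP[_ qx]] /andP[_ /andP[_ rx]].
  apply: le_D; rewrite natrM; apply: le_trans (ler_pM _ _ qx rx) _ => //.
  by rewrite powM; apply: pow_le; clear - eps8; lra.
have WN q : q \in W -> (N < q * Dp.+1)%N.
  rewrite inE => /andP[_ /andP[qt _]]; rewrite -(ltr_nat R) natrM.
  apply: le_lt_trans NN _.
  have -> : x = t * x `^ (1 - 2 * eps).
    by rewrite powM addrC subrK powRr1// ltW.
  by apply: ltr_pM => //; apply: ltW; exact: powE.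
have := sieve_estimate R N v g D tau v_ge0 v_sum g_ge0 g1 gM g_lo g_hi tauP X W k z L Dp C lam
  XP XC z0 zD zN DpD WP WD WN V1 Vk tau1 lam0 X1 w X1P X1X X1D w0.
have wX q : q \in X -> (w <= q)%N by rewrite inE => /andP[].
move=> /(_ wX); rewrite X1U -/(main_sum N Q w k Dp).
have -> : \prod_(q in X1) (1 - g q) = \prod_(q in Q | (q < w)%N) (1 - g q).
  by apply: eq_bigl => q; rewrite inE.
move=> h; apply: le_trans h _; rewrite -/V.
have b1 : lam * (4 ^+ L * (expR (8 * C) + 16 ^+ k * tau)) <= delta / 8.
  apply: (@le_trans _ _ (lam * B)).
    rewrite ler_wpM2l ?(ltW lam0)// /B ler_wpM2l ?exprn_ge0// lerD2l.
    by rewrite mulrC -ler_pdivlMr ?exprn_gt0// mul1r.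
  by rewrite /lam le_eqVlt; apply/orP; left; apply/eqP; field; rewrite gt_eqF.
have b2 : 28 / (V * lam) <= delta / 8.
  have h : 224 / (delta * lam) <= V by clear - hV kk; lra.
  have dl0 : 0 < delta * lam by rewrite mulr_gt0.
  rewrite (ler_pdivrMr _ _ dl0) in h.
  have V0 : 0 < V by clear - V1; lra.
  have Vl : 0 < V * lam by rewrite mulr_gt0.
  rewrite ler_pdivrMr//.
  by rewrite (_ : delta / 8 * (V * lam) = V * (delta * lam) / 8); [clear - h; lra|field].
move: hk b1 b2 taud hwk.
set a1 := 2 ^- k * _; set a2 := lam * _; set a3 := 28 / _; set a4 := k%:R / _ * _; clear - d0; lra.
Qed.

End SieveLevel.

(** * Integers and shifted primes *)

Section Assembly.
Import fintype finset.
Local Open Scope set_scope.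
Variable R : realType.
Implicit Types (x : R) (P : pred nat).

(** The factor 1 - 1 / (q - 1)^2 = q (q - 2) / (q - 1)^2 telescopes over consecutive integers;
    omitting factors only increases the product. *)
Lemma twin_prod_nat_ge (a j : nat) (P : pred nat) :
  (a.+1%:R / a.+2%:R) * ((a.+2 + j)%:R / (a.+1 + j)%:R) <=
  \prod_(a.+3 <= q < a.+3 + j | P q) (1 - ((q.-1)%:R ^+ 2)^-1) :> R.
Proof.
elim: j => [|j IH].
  rewrite !addn0 big_geq// le_eqVlt; apply/orP; left; apply/eqP.
  by rewrite mulf_div [X in X / _]mulrC divff// mulf_neq0 ?pnatr_eq0.
rewrite (addnS a.+3 j) big_mkcond big_nat_recr ?leq_addr//= -big_mkcond/=.
set F := \prod_(_ <= _ < _ | _) _ in IH *.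
rewrite (_ : a.+2 + j.+1 = (a.+1 + j).+2)%N; last lia.
rewrite (_ : a.+1 + j.+1 = (a.+1 + j).+1)%N; last lia.
move: IH; rewrite (_ : a.+2 + j = (a.+1 + j).+1)%N; last lia.
have : (0 < a.+1 + j)%N by lia.
have c0 : 0 <= a.+1%:R / a.+2%:R :> R by rewrite divr_ge0.
move: (_ / _) c0 => c c0.
move: (a.+1 + j)%N => m m0; rewrite -(natr1 m.+1) -(natr1 m).
have m1 : (1 : R) <= m%:R by rewrite ler1n.
move=> IH.
case: ifP => _; last first.
  rewrite mulr1; apply: le_trans IH; rewrite ler_wpM2l//.
  rewrite ler_pdivrMr; last lra.
  rewrite mulrAC ler_pdivlMr; last lra.
  by nra.
have f0 : 0 <= 1 - ((m%:R + 1) ^+ 2)^-1 :> R.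
  rewrite subr_ge0 invf_le1; first by rewrite exprn_ege1//; lra.
  by rewrite exprn_gt0//; lra.
apply: le_trans (ler_wpM2r f0 IH).
rewrite -mulrA ler_wpM2l// le_eqVlt; apply/orP; left; apply/eqP.
by field; apply/andP; split; rewrite gt_eqF//; lra.
Qed.

Lemma twin_prod_ge (w N : nat) (P : pred nat) : (3 <= w)%N ->
  1 - (w.-1)%:R^-1 <=
  \prod_(0 <= q < N.+1 | P q && (w <= q)%N) (1 - ((q.-1)%:R ^+ 2)^-1) :> R.
Proof.
move=> w3; rewrite -(big_nat_widenl w 0)//.
have [wN|wN] := ltnP N w.
  by rewrite big_geq// gerBl invr_ge0.
case: w w3 wN => [|[|[|a]]]// _ aN.
have -> : N.+1 = (a.+3 + (N.+1 - a.+3))%N by lia.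
apply: le_trans (twin_prod_nat_ge a (N.+1 - a.+3) P).
set j := (_ - _)%N.
rewrite (_ : a.+2 + j = (a.+1 + j).+1)%N; last lia.
have h : 1 <= (a.+1 + j).+1%:R / (a.+1 + j)%:R :> R.
  by rewrite ler_pdivlMr ?ltr0n ?addSn// mul1r ler_nat.
apply: le_trans (ler_peMr _ h); last by rewrite divr_ge0.
rewrite /= le_eqVlt; apply/orP; left; apply/eqP.
have := ler0n R a.+1; rewrite -(natr1 a.+1); move: (a.+1%:R) => y y0.
by field; rewrite gt_eqF//; lra.
Qed.

Lemma shifted_prime_sum (N : nat) (F : nat -> R) :
  \sum_(p < N.+1 | prime p) F p.-1 =
  \sum_(1 <= n < N.+1) (prime n.+1 && (n < N)%N)%:R * F n.
Proof.
rewrite -(big_mkord prime (fun p => F p.-1)) big_mkcond big_nat_recl//= add0r.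
case: N => [|N]; first by rewrite !big_geq.
rewrite big_nat_recl//= add0r [RHS]big_nat_recr//= ltnn andbF mul0r addr0 big_add1/=.
rewrite big_nat_cond [RHS]big_nat_cond; apply: eq_bigr => i /andP[/andP[_ iN] _].
by rewrite ltnS iN andbT; case: (prime _); rewrite ?mul1r ?mul0r.
Qed.

Definition excluded (N : nat) (P : pred nat) : {set 'I_N.+1} :=
  [set q : 'I_N.+1 | prime q && (nat_of_ord q \notin P)].

Lemma excluded_sub N P : excluded N P \subset primeset N.
Proof. by apply/subsetP => q; rewrite !inE => /andP[]. Qed.

Lemma excluded_sifted N P n : (0 < n <= N)%N ->
  (excluded N P :&: prime_divs N n == finset.set0) = all (fun q => q \in P) (primes n).
Proof.
move=> /andP[n0 nN]; apply/eqP/allP => [e q|h].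
  rewrite mem_primes => /and3P[pq _ qn]; apply/negPn/negP => qP.
  have qN : (q < N.+1)%N by rewrite ltnS (leq_trans _ nN)// dvdn_leq.
  have : Ordinal qN \in excluded N P :&: prime_divs N n by rewrite !inE/= pq qP qn.
  by rewrite e inE.
apply/finset.setP => q; rewrite !inE; apply/negP => /andP[/andP[pq qP] /andP[_ qn]].
by move: qP; rewrite h// mem_primes pq n0.
Qed.

Lemma mean_uniform_Psi x P : 0 < x ->
  mean R (Num.truncn x) (fun=> x^-1)
    (fun n => (excluded (Num.truncn x) P :&: prime_divs (Num.truncn x) n == finset.set0)%:R) =
  (Psi x P)%:R / x.
Proof.
move=> x0; rewrite /mean -mulr_sumr mulrC; congr (_ / _).
rewrite /Psi natr_sum [RHS]big_mkcond [LHS]big_nat_cond [RHS]big_nat_cond; apply: eq_bigr => n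
  /andP[hn _].
by rewrite excluded_sifted//; case: all.
Qed.

(** Each modulus has discrepancy at most 2 / x, and there are at most x^(1 - eps) of them. *)
Lemma level_density_uniform x (eps : R) : 1 <= x ->
  level_density R (Num.truncn x) (Num.truncn (x `^ (1 - eps))) (2 * x `^ (- eps))
    (fun=> x^-1) (fun d => d%:R^-1).
Proof.
move=> x1; have x0 : 0 < x by lra.
set N := Num.truncn x.
have NN : (N%:R : R) <= x by rewrite truncn_le; lra.
have xN : x < N.+1%:R by exact: truncnS_gt.
rewrite -natr1 in xN.
split=> //.
- by move=> n; rewrite invr_ge0 ltW.
- by rewrite sumr_const_nat subn1/= -(mulr_natr x^-1) mulrC ler_pdivrMr// mul1r.
- by rewrite invr1.
- by move=> a b _; rewrite natrM invfM.
- move=> q pq; have q0 : (0 : R) < q%:R by rewrite ltr0n prime_gt0.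
  by rewrite ger_pMl ?invr_gt0// gerBl invr_ge0.
set D := Num.truncn _.
have DX : (D%:R : R) <= x `^ (1 - eps) by rewrite truncn_le powR_ge0.
apply: (@le_trans _ _ (\sum_(1 <= d < D.+1) 2 / x)).
  rewrite big_nat_cond [leRHS]big_nat_cond; apply: ler_sum => d /andP[/andP[d1 _] _].
  have -> : mean R N (fun=> x^-1) (fun n => (d %| n)%N%:R) = (N %/ d)%:R / x.
    by rewrite /mean -mulr_sumr -natr_sum -divn_count_dvd mulrC.
  have d0 : (0 : R) < d%:R by rewrite ltr0n.
  have d1' : (1 : R) <= d%:R by rewrite ler1n.
  have h1 : (N %/ d)%:R * d%:R <= N%:R :> R by rewrite -natrM ler_nat leq_trunc_div.
  have h2 : N%:R < ((N %/ d)%:R + 1) * d%:R :> R by rewrite natr1 -natrM ltr_nat ltn_ceil.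
  rewrite (_ : (N %/ d)%:R / x - d%:R^-1 = ((N %/ d)%:R * d%:R - x) / (d%:R * x)); last first.
    by field; rewrite !gt_eqF.
  rewrite normrM normfV (gtr0_norm (mulr_gt0 d0 x0)) ler_pdivrMr ?mulr_gt0//.
  rewrite (_ : 2 / x * (d%:R * x) = 2 * d%:R); last by field; rewrite gt_eqF.
  by rewrite ler_norml; apply/andP; split; lra.
rewrite sumr_const_nat subn1/= -(mulr_natr (2 / x)) -!mulrA ler_wpM2l//.
rewrite mulrC ler_pdivrMr//; apply: le_trans DX _.
by rewrite addrC powRD ?powRr1 ?(ltW x0)//; apply/implyP => _; rewrite gt_eqF.
Qed.

Lemma mean_shifted_primepiP x P :
  mean R (Num.truncn x)
    (fun n => (prime n.+1 && (n < Num.truncn x)%N)%:R / (primepi x)%:R)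
    (fun n => (excluded (Num.truncn x) P :&: prime_divs (Num.truncn x) n == finset.set0)%:R) =
  (primepiP x P)%:R / (primepi x)%:R.
Proof.
rewrite /mean; under eq_bigr do rewrite mulrAC.
rewrite -mulr_suml -shifted_prime_sum; congr (_ / _).
rewrite /primepiP natr_sum [RHS]big_mkcondr/=; apply: eq_bigr => p pp.
rewrite excluded_sifted; first by case: all.
have := prime_gt1 pp; have := ltn_ord p; lia.
Qed.

Lemma level_density_shifted x (D : nat) : (0 < primepi x)%N ->
  level_density R (Num.truncn x) D
    ((\sum_(1 <= d < D.+1)
          `|(primepi_ap x d 1)%:R - (primepi x)%:R / (totient d)%:R|) / (primepi x)%:R)
    (fun n => (prime n.+1 && (n < Num.truncn x)%N)%:R / (primepi x)%:R)
    (fun d => (totient d)%:R^-1).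
Proof.
move=> pi0; have pi0' : (0 : R) < (primepi x)%:R by rewrite ltr0n.
have totq q : prime q -> (totient q)%:R = q%:R - 1 :> R.
  by move=> pq; rewrite totient_prime// -subn1 natrB// prime_gt0.
split.
- by move=> n; rewrite divr_ge0.
- rewrite -mulr_suml ler_pdivrMr// mul1r.
  under eq_bigr do rewrite -[_%:R]mulr1.
  by rewrite -(shifted_prime_sum _ (fun=> 1)) /primepi natr_sum.
- by move=> d; rewrite invr_ge0.
- by rewrite (_ : totient 1 = 1%N)// invr1.
- by move=> a b cab; rewrite totient_coprime// natrM invfM.
- move=> q pq; rewrite totq//; have : (2 : R) <= q%:R by rewrite ler_nat prime_gt1.
  by move=> q2; rewrite lef_pV2 ?posrE; lra.
- move=> q pq; rewrite totq//; have : (2 : R) <= q%:R by rewrite ler_nat prime_gt1.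
  move=> q2; rewrite le_eqVlt; apply/orP; left; apply/eqP; field.
  by apply/andP; split; rewrite gt_eqF//; lra.
rewrite mulr_suml big_nat_cond [leRHS]big_nat_cond; apply: ler_sum => d _.
have -> : mean R (Num.truncn x)
    (fun n => (prime n.+1 && (n < Num.truncn x)%N)%:R / (primepi x)%:R)
    (fun n => (d %| n)%N%:R) = (primepi_ap x d 1)%:R / (primepi x)%:R.
  rewrite /mean; under eq_bigr do rewrite mulrAC.
  rewrite -mulr_suml -(shifted_prime_sum _ (fun n => (d %| n)%N%:R)); congr (_ / _).
  rewrite /primepi_ap natr_sum [RHS]big_mkcondr/=; apply: eq_bigr => p pp.
  by rewrite eqn_mod_dvd ?prime_gt0// subn1; case: (_ %| _)%N.
have -> : (primepi_ap x d 1)%:R / (primepi x)%:R - (totient d)%:R^-1 =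
  ((primepi_ap x d 1)%:R - (primepi x)%:R / (totient d)%:R) / (primepi x)%:R :> R.
  by rewrite mulrBl mulrAC divff ?mul1r// gt_eqF.
by rewrite normrM normfV (gtr0_norm pi0').
Qed.

Lemma Psi_sifted x P : (\sum_(0 <= n < (Num.truncn x).+1 | sifted (fun q => q \notin P) n) 1 : R) =
  (Psi x P)%:R.
Proof.
rewrite big_mkcond big_nat_recl//= add0r /Psi natr_sum [RHS]big_mkcond big_add1/=.
apply: eq_bigr => n _; rewrite /sifted /=.
by rewrite (eq_all (a2 := fun q => q \in P)) // => q; rewrite negbK.
Qed.

End Assembly.

(** * Comparison of the two sieved proportions *)

Section Ratio.
Import fintype finset.
Local Open Scope set_scope.
Variable R : realType.

Lemma primepi_gt0 (x : R) : 2 <= x -> (0 < primepi x)%N.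
Proof.
move=> x2; have h : (2 < (Num.truncn x).+1)%N by rewrite ltnS truncn_ge_nat//; lra.
by rewrite /primepi (bigD1 (Ordinal h)).
Qed.

(** [P1] and [P2] are the parts of the product below and above w. The numerator P1 P2 EA - EB
    consists of three errors of size at most e, and the denominator is at least c / 2. *)
Lemma ratio_close (EA EB cA M P1 P2 e c : R) :
  0 <= EA <= 1 -> c <= EA -> 0 < c -> 0 <= P1 <= 1 -> P2 <= 1 ->
  1 / 2 <= P1 * P2 -> 1 - P2 <= e ->
  `|EA - cA * M| <= e -> `|EB - P1 * cA * M| <= e ->
  `|1 - EB / (P1 * P2 * EA)| <= 6 * e / c.
Proof.
move=> /andP[EA0 EA1] cEA c0 /andP[P10 P11] P21 P12 P2e h1 h2.
have h0 : 0 < P1 * P2 * EA by rewrite mulr_gt0//; lra.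
rewrite (_ : 1 - EB / (P1 * P2 * EA) = (P1 * P2 * EA - EB) / (P1 * P2 * EA)); last first.
  by rewrite mulrBl divff// gt_eqF.
rewrite normrM normfV (gtr0_norm h0) ler_pdivrMr//.
have h3 : `|P1 * P2 * EA - EB| <= 3 * e.
  rewrite (_ : P1 * P2 * EA - EB = P1 * (EA - cA * M) - (EB - P1 * cA * M) - P1 * EA * (1 - P2));
    last ring.
  apply: le_trans (ler_normB _ _) _; rewrite (_ : 3 * e = e + e + e); last ring.
  apply: lerD; last first.
    rewrite !normrM (ger0_norm P10) (ger0_norm EA0) ger0_norm; last lra.
    have : P1 * EA <= 1 by nra.
    have : 0 <= P1 * EA by nra.
    by nra.
  apply: le_trans (ler_normB _ _) _; apply: lerD => //.
  by rewrite normrM (ger0_norm P10); have := normr_ge0 (EA - cA * M); nra.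
have e0 : 0 <= e by apply: le_trans h1.
apply: le_trans h3 _.
rewrite mulrAC ler_pdivlMr// -mulrA; have : c <= 2 * (P1 * P2 * EA) by nra.
by nra.
Qed.

Lemma shifted_ratio_eventually (P : R -> pred nat) (X0 C : R) :
  (forall eps : R, 0 < eps ->
     (\sum_(1 <= d < (Num.truncn (powR x (1 - eps))).+1)
          `|(primepi_ap x d 1)%:R - (primepi x)%:R / (totient d)%:R|)
       / (primepi x)%:R @[x --> +oo] --> (0 : R)) ->
  (forall x : R, X0 <= x -> 2%N \in P x /\
         \sum_(p < (Num.truncn x).+1 | prime p && (nat_of_ord p \notin P x)) (p%:R)^-1 <= C) ->
  forall eta : R, 0 < eta -> exists X1 : R, forall x, X1 < x ->
  `|1 - ((primepiP x (P x))%:R / (primepi x)%:R)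
    / ((\prod_(p < (Num.truncn x).+1 | prime p && (nat_of_ord p \notin P x))
          (1 - ((p.-1)%:R ^+ 2)^-1))
       * ((Psi x (P x))%:R / x))| <= eta.
Proof.
move=> EH hP eta eta0.
have [c0 c00 [N0 hc]] := sifted_lower_bound R C.
(* The half pays for passing from the integer part N to x. *)
pose c := c0 / 2; have c_gt0 : 0 < c by rewrite divr_gt0.
pose e := eta * c / 6.
have e0 : 0 < e by rewrite divr_gt0// mulr_gt0.
have [k [w0 hw]] := sieve_level R C e e0.
have [w1 hw1] := exists_nat_ge R (e^-1).
(* Besides the demand of the sieve, w - 1 >= 1 / e makes the part of the product over q >= w differ
   from 1 by at most e. *)
pose w := (maxn w0 (w1 + 4))%N.
have [eps [tau0 [X2 [eps0 tau00 hsieve]]]] := hw w (leq_maxl _ _).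
have w3 : (3 <= w)%N by rewrite /w; lia.
have we : (w.-1%:R^-1 : R) <= e.
  have w0' : (0 : R) < w.-1%:R by rewrite ltr0n; lia.
  rewrite -[leRHS]invrK lef_pV2 ?posrE ?invr_gt0//.
  by apply: le_trans hw1 _; rewrite ler_nat /w; lia.
have /cvgrPdist_le /(_ tau0 tau00) [X3 [_ hX3]] := EH eps eps0.
pose X4 := expR (ln (2 / tau0) / eps).
exists (Num.max (Num.max (Num.max X0 X2) (Num.max X3 X4)) (N0%:R + 4)) => x.
rewrite !gt_max => /andP[/andP[/andP[xX0 xX2] /andP[xX3 xX4]] xN0].
have N0_ge0 : (0 : R) <= N0%:R by [].
have x4 : 4 < x by clear - N0_ge0 xN0; lra.
have x0 : 0 < x by clear - x4; lra.
have [P2 hC] := hP x (ltW xX0).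
set N := Num.truncn x in hC *.
have NN : (N%:R : R) <= x by rewrite truncn_le ltW.
have xN : x < N%:R + 1 by rewrite natr1 truncnS_gt.
have pi0 : (0 < primepi x)%N by apply: primepi_gt0; clear - x4; lra.
pose Q := excluded N (P x).
have QC : \sum_(q in Q) (q%:R^-1 : R) <= C.
  by rewrite (eq_bigl (fun q : 'I_N.+1 => prime q && (nat_of_ord q \notin P x))) // => q; rewrite inE.
have hB := hsieve x Q (ltW xX2) (excluded_sub N (P x)) QC _ _ _ _ (level_density_shifted R x _ pi0).
have tauA : 2 * x `^ (- eps) <= tau0.
  have h : 2 / tau0 <= x `^ eps.
    apply: powR_ge_of_ln; rewrite ?divr_gt0//.
    have : ln (2 / tau0) / eps <= ln x by rewrite -ler_expR (@lnK R x) ?posrE// ltW.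
    by rewrite ler_pdivrMr// => h; apply: le_trans h _; rewrite mulrC.
  by rewrite powRN ler_pdivrMr ?powR_gt0// mulrC -ler_pdivrMr.
have x1 : 1 <= x by clear - x4; lra.
have hA := hsieve x Q (ltW xX2) (excluded_sub N (P x)) QC _ _ _ tauA (level_density_uniform R x eps x1).
have tauB : (\sum_(1 <= d < (Num.truncn (x `^ (1 - eps))).+1)
     `|(primepi_ap x d 1)%:R - (primepi x)%:R / (totient d)%:R|) / (primepi x)%:R <= tau0.
  have := hX3 x xX3; rewrite sub0r normrN; apply: le_trans; exact: ler_norm.
have {}hB := hB tauB.
rewrite mean_uniform_Psi// in hA.
rewrite mean_shifted_primepiP in hB.
set EA := (Psi x (P x))%:R / x in hA *.
set EB := (primepiP x (P x))%:R / (primepi x)%:R in hB *.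
pose tw (q : nat) : R := 1 - (q.-1%:R ^+ 2)^-1.
have Q3 (q : nat) : prime q && (q \notin P x) -> (3 <= q)%N.
  case/andP => pq qP; have := prime_gt1 pq; rewrite leq_eqVlt => /orP[/eqP q2|//].
  by move: qP; rewrite -q2 P2.
pose P1 := \prod_(q in Q | (q < w)%N) tw q.
pose PP2 := \prod_(q in Q | ~~ (q < w)%N) tw q.
have tw01 (q : nat) : (3 <= q)%N -> 0 <= tw q <= 1.
  move=> q3; rewrite /tw gerBl invr_ge0 sqr_ge0 andbT subr_ge0.
  have h : (1 : R) <= q.-1%:R by case: q q3 => [|[|q]]// _; rewrite ler1n.
  by rewrite invf_le1 ?exprn_ege1// exprn_gt0//; clear - h; lra.
have twQ q : q \in Q -> 0 <= tw q <= 1 by rewrite inE => /Q3/tw01.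
have prodE : \prod_(p < N.+1 | prime p && (nat_of_ord p \notin P x)) (1 - ((p.-1)%:R ^+ 2)^-1) = P1
  * PP2.
  rewrite (eq_bigl (fun q => q \in Q)); last by move=> q; rewrite inE.
  by rewrite (bigID (fun q : 'I_N.+1 => (q < w)%N)).
rewrite prodE.
have P1_01 : 0 <= P1 <= 1.
  apply/andP; split; first by apply: prodr_ge0 => q /andP[/twQ/andP[]].
  by apply: prodr_ile1 => q /andP[/twQ].
have PP2_1 : PP2 <= 1 by apply: prodr_ile1 => q /andP[/twQ].
have half : 1 / 2 <= P1 * PP2.
  rewrite -prodE -(big_mkord (fun p => prime p && (p \notin P x)) tw).
  rewrite (eq_bigl (fun q => (prime q && (q \notin P x)) && (3 <= q)%N)); last first.
    by move=> q; case: (boolP (prime q && _)) => // /Q3->.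
  apply: le_trans (twin_prod_ge R 3 N _ _) => //=; clear; lra.
have P2e : 1 - PP2 <= e.
  have := twin_prod_ge R w N (fun p => prime p && (p \notin P x)) w3.
  rewrite big_mkord -/PP2.
  have -> : \prod_(i < N.+1 | prime i && (nat_of_ord i \notin P x) && (w <= i)%N) (1 - ((i.-1)%:R
    ^+ 2)^-1) = PP2.
    by apply: eq_bigl => q; rewrite inE -leqNgt.
  by clear - we; lra.
have cE : c <= EA.
  rewrite /EA /c -Psi_sifted ler_pdivlMr//.
  apply: le_trans (hc N (fun q => q \notin P x) _ _); last 2 first.
  - by rewrite -(ler_nat R); clear - xN0 xN; lra.
  - by apply: le_trans hC; rewrite big_mkord.
  by clear - c00 xN x4; nra.
have EA01 : 0 <= EA <= 1.
  rewrite divr_ge0 ?(ltW x0)//= ler_pdivrMr// mul1r; apply: le_trans NN.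
  rewrite ler_nat /Psi; apply: (@leq_trans (\sum_(1 <= n < N.+1) 1)%N).
    by rewrite big_mkcond; apply: leq_sum => n _; case: ifP.
  by rewrite sum_nat_const_nat subn1 muln1.
set M := main_sum _ _ _ _ _ _ in hA hB.
set cA := \prod_(q in Q | (q < w)%N) (1 - q%:R^-1) in hA.
(* The local identity 1 - 1 / (q - 1) = (1 - 1 / (q - 1)^2) (1 - 1 / q) produces the factors of the
   theorem. *)
have cBE : \prod_(q in Q | (q < w)%N) (1 - (totient q)%:R^-1) = P1 * cA.
  rewrite /P1 /cA -big_split/=; apply: eq_bigr => q /andP[qQ _].
  move: qQ; rewrite inE => qQ; have q3 := Q3 _ qQ; case/andP: qQ => pq _.
  rewrite totient_prime// /tw.
  have h3 : (3 : R) <= q%:R by rewrite ler_nat.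
  rewrite -subn1 natrB ?prime_gt0//; field.
  by rewrite !gt_eqF//; clear - h3; lra.
rewrite cBE in hB.
have := ratio_close EA EB cA M P1 PP2 e c EA01 cE c_gt0 P1_01 PP2_1 half P2e hA hB.
move/le_trans; apply; rewrite /e le_eqVlt; apply/orP; left; apply/eqP; field.
by rewrite gt_eqF.
Qed.

End Ratio.

Theorem theorem1 (R : realType) (P : R -> pred nat) :
  (* hypothesis: for every fixed eps > 0,
     sum_{d <= x^(1-eps)} |pi(x;d,1) - pi(x)/phi(d)| = o(pi(x)) *)
  (forall eps : R, 0 < eps ->
     (\sum_(1 <= d < (Num.truncn (powR x (1 - eps))).+1)
          `|(primepi_ap x d 1)%:R - (primepi x)%:R / (totient d)%:R|)
       / (primepi x)%:R @[x --> +oo] --> (0 : R)) ->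
  (* for each large x, P(x) is a set of primes less than x, containing 2,
     with sum_{p <= x, p notin P(x)} 1/p bounded independently of x *)
  (exists X0 C : R, forall x : R, X0 <= x ->
     [/\ (forall p : nat, p \in P x -> prime p && (p%:R < x)),
         2%N \in P x &
         \sum_(p < (Num.truncn x).+1 | prime p && (nat_of_ord p \notin P x)) (p%:R)^-1 <= C]) ->
  (* conclusion: pi(x,P)/pi(x) ~ prod_{p <= x, p notin P}(1 - 1/(p-1)^2) * Psi(x,P)/x *)
  ((primepiP x (P x))%:R / (primepi x)%:R)
    / ((\prod_(p < (Num.truncn x).+1 | prime p && (nat_of_ord p \notin P x))
          (1 - ((p.-1)%:R ^+ 2)^-1))
       * ((Psi x (P x))%:R / x))
    @[x --> +oo] --> (1 : R).
Proof.
move=> EH [X0 [C hP]]; apply/cvgrPdist_le => eta eta0.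
have [|X1 hX1] := @shifted_ratio_eventually R P X0 C EH _ eta eta0.
  by move=> x /hP[].
by exists X1; split=> //; exact: num_real.
Qed.
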